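(* Let $e,n\ge 1$ be integers, let $y_1,\dots,y_{e-1}\in\Bbbk=\mathbb{Q}(q,u_1,\dots,u_e)$, and let $\alpha\in B_{\mathrm{aff},n}$ be a mixed braid with $n$ strands. Let $\alpha_0\in B_n$ be the braid obtained from $\alpha$ by deleting all powers of $t_0$ appearing in $\alpha$ (i.e. the image of $\alpha$ under the homomorphism $B_{\mathrm{aff},n}\to B_n$ with $t_0\mapsto 1$, $t_i\mapsto t_i$ for $1\le i\le n-1$), let $wr_0(\alpha)$ be the sum of the exponents of $t_0$ appearing in $\alpha$, and let $\Delta(\widehat{\alpha_0})$ be the usual Alexander polynomial of the closure of $\alpha_0$. Then $$\Delta^{G(e,1)}(\widehat{\alpha})=\Delta(\widehat{\alpha_0})\sum_{1\le p\le e}C(e,p)\,u_p^{wr_0(\alpha)}\Bigg(\prod_{1\le l\le e,\ l\ne p}\frac{1}{u_p-u_l}\Bigg),$$ where $$C(e,p)=\sum_{i=1}^{e-1}\Big(u_p^{e-i-1}\sum_{j=1}^{i}(-1)^{i-j}y_j\sigma_{i-j}\Big)+(-1)^{e-1}\prod_{1\le l\le e,\ l\ne p}u_l$$ and $\sigma_d$ is the $d$-th elementary symmetric polynomial in $u_1,\dots,u_e$ ($\sigma_0=1$).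
   Context: $\Bbbk=\mathbb{Q}(q,u_1,\dots,u_e)$ with $q,u_1,\dots,u_e$ indeterminates. Empty sums are $0$, empty products are $1$. Affine braid group: $B_{\mathrm{aff},n}$ is the group with generators $t_0,t_1,\dots,t_{n-1}$ and relations $t_0t_1t_0t_1=t_1t_0t_1t_0$, $t_it_j=t_jt_i$ ($|i-j|\ge2$), $t_it_{i+1}t_i=t_{i+1}t_it_{i+1}$ ($1\le i\le n-2$). Its elements are called mixed braids with $n$ strands (they represent braids in the complement of a fixed vertical cylinder, $t_0$ being the loop of the first strand around the cylinder), and the closure $\widehat\alpha$ of $\alpha$ is a link in the solid torus (a mixed link). $B_n=\langle t_1,\dots,t_{n-1}\rangle$ is the usual braid group. Ariki-Koike algebra: $H_{e,n}$ is the $\Bbbk$-algebra with generators $T_0,\dots,T_{n-1}$ and relations $(T_0-u_1)\cdots(T_0-u_e)=0$, $(T_i-q)(T_i+1)=0$ ($1\le i\le n-1$), $T_0T_1T_0T_1=T_1T_0T_1T_0$, $T_iT_j=T_jT_i$ ($|i-j|\ge2$), $T_iT_{i+1}T_i=T_{i+1}T_iT_{i+1}$ ($1\le i\le n-2$). One has $H_{e,1}\subset H_{e,2}\subset\cdots$; put $H_{e,0}=\Bbbk$, $H_e=\bigcup_n H_{e,n}$ and $L_i=T_i\cdots T_1T_0T_1^{-1}\cdots T_i^{-1}$ ($i\ge0$). Let $\pi_n:B_{\mathrm{aff},n}\to H_{e,n}^{\times}$ be the homomorphism $t_i\mapsto T_i$. Markov trace: for parameters $z,y_1,\dots,y_{e-1}$,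 the Markov trace $\tau$ is the unique linear map on $H_e$ with $\tau(1)=1$; $\tau(hh')=\tau(h'h)$; $\tau(hT_n)=z\tau(h)$ for $h\in H_{e,n}$, $n\ge1$; $\tau(hL_n^{j})=y_j\tau(h)$ for $h\in H_{e,n}$, $n\ge0$, $1\le j\le e-1$ (existence and uniqueness are due to Lambropoulou). Invariants: let $t$ be a new variable, extend scalars to $\Bbbk(t)$, and take $z=-\frac{1-q}{1-tq}$ (equivalently $t=\frac{1-q+z}{qz}$), with $y_1,\dots,y_{e-1}\in\Bbbk$ independent of $t$. For $\alpha\in B_{\mathrm{aff},n}$ put $$X_{\widehat\alpha}(q,t)=\Big[-\frac{1-tq}{t^{1/2}(1-q)}\Big]^{n-1}(t^{1/2})^{wr(\widehat\alpha)}\,\tau(\pi_n(\alpha)),$$ where the writhe $wr(\widehat\alpha)$ is the exponent sum of the generators $t_1,\dots,t_{n-1}$ in $\alpha$ (powers of $t_0$ are not counted). This expression has no pole at $t^{1/2}=q^{-1/2}$, and the Alexander polynomial of type $G(e,1)$ is $\Delta^{G(e,1)}(\widehat\alpha)=X_{\widehat\alpha}(q,q^{-1})$ (the value at $t^{1/2}=q^{-1/2}$). The usual Alexander polynomial $\Delta(L)$ of an oriented link $L$ in $S^3$ is normalized by $\Delta(\text{unknot})=1$ and $\Delta(L_+)-\Delta(L_-)=(q^{1/2}-q^{-1/2})\Delta(L_0)$, where the braid generators $t_i$ ($i\ge1$) are positive crossings; equivalently, for a braid $\beta\in B_n$, $\Delta(\widehat\beta)$ is the value at $t^{1/2}=q^{-1/2}$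 of $\big[-\frac{1-tq}{t^{1/2}(1-q)}\big]^{n-1}(t^{1/2})^{wr(\widehat\beta)}\,\tau(\pi_n(\beta))$, where $\tau$ is the Markov trace with parameter $z=-\frac{1-q}{1-tq}$ for $e=1$, $u_1=1$ (so that $T_0=1$ and $H_{1,n}$ is the Iwahori-Hecke algebra of type $A_{n-1}$), i.e. it is $\Delta^{G(1,1)}(\widehat\beta)$ with $u_1=1$. *)

(* Defs.v *)
From HB Require Import structures.
From mathcomp Require Import all_boot all_order all_algebra.
From mathcomp Require Import boolp classical_sets.
From mathcomp Require Import mpoly.

Set Implicit Arguments.
Unset Strict Implicit.
Unset Printing Implicit Defensive.

Import GRing.Theory Num.Theory.
Local Open Scope ring_scope.
Local Open Scope quotient_scope.

(* The letter (i, false) stands for the generator i, (i, true) for its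
   inverse. *)
Definition word (I : Type) := seq (I * bool).

Definition pos_word (I : Type) (s : seq I) : word I := [seq (i, false) | i <- s].

Definition inv_word (I : Type) (w : word I) : word I :=
  rev [seq (x.1, ~~ x.2) | x <- w].

Section PresentedGroup.
Variables (I : choiceType) (R : word I -> word I -> Prop).

Inductive word_eq : word I -> word I -> Prop :=
| word_eq_refl w : word_eq w w
| word_eq_sym v w : word_eq v w -> word_eq w v
| word_eq_trans v u w : word_eq u v -> word_eq v w -> word_eq u w
| word_eq_cat v v' w w' :
    word_eq v v' -> word_eq w w' -> word_eq (v ++ w) (v' ++ w')
| word_eq_cancel i b : word_eq [:: (i, b); (i, ~~ b)] [::]
| word_eq_rel v w : R v w -> word_eq v w.

Definition word_eqb (v w : word I) : bool := `[< word_eq v w >].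

Lemma word_eqb_refl : reflexive word_eqb.
Proof. by move=> w; apply/asboolP; apply: word_eq_refl. Qed.

Lemma word_eqb_sym : ssrbool.symmetric word_eqb.
Proof. by move=> v w; apply/asboolP/asboolP; apply: word_eq_sym. Qed.

Lemma word_eqb_trans : transitive word_eqb.
Proof.
by move=> v u w /asboolP uv /asboolP vw; apply/asboolP; apply: word_eq_trans vw.
Qed.

Canonical word_equiv := EquivRel word_eqb word_eqb_refl word_eqb_sym word_eqb_trans.

Definition pgroup := {eq_quot word_equiv}.

HB.instance Definition _ := Choice.on pgroup.
HB.instance Definition _ := EqQuotient.on pgroup.

Lemma pgroupP (v w : word I) : word_eq v w <-> \pi_pgroup v = \pi_pgroup w.
Proof.
split=> [vw|]; first by apply/eqmodP/asboolP.
by move=> /eqmodP /asboolP.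
Qed.

Lemma word_eq_repr (w : word I) : word_eq (repr (\pi_pgroup w)) w.
Proof. by apply/pgroupP; rewrite reprK. Qed.

Lemma inv_word_cat (v w : word I) : inv_word (v ++ w) = inv_word w ++ inv_word v.
Proof. by rewrite /inv_word map_cat rev_cat. Qed.

Lemma inv_wordK : involutive (@inv_word I).
Proof.
move=> w; rewrite /inv_word map_rev revK -map_comp -[RHS]map_id.
by apply: eq_map => -[i b] /=; rewrite negbK.
Qed.

Lemma word_eq_mulV (w : word I) : word_eq (w ++ inv_word w) [::].
Proof.
elim: w => [|[i b] w IH]; first exact: word_eq_refl.
rewrite -cat1s inv_word_cat -catA (catA w).
apply: (@word_eq_trans ([:: (i, b)] ++ ([::] ++ [:: (i, ~~ b)]))).
  apply: word_eq_cat; first exact: word_eq_refl.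
  by apply: word_eq_cat => //; apply: word_eq_refl.
exact: word_eq_cancel.
Qed.

Lemma word_eq_inv (v w : word I) :
  word_eq v w -> word_eq (inv_word v) (inv_word w).
Proof.
move=> vw.
apply: (@word_eq_trans (inv_word v ++ (w ++ inv_word w))).
  rewrite -{1}[inv_word v]cats0; apply: word_eq_cat; first exact: word_eq_refl.
  by apply: word_eq_sym; apply: word_eq_mulV.
rewrite catA -[X in word_eq _ X]cat0s; apply: word_eq_cat; last exact: word_eq_refl.
apply: (@word_eq_trans (inv_word v ++ v)).
  by apply: word_eq_cat; [exact: word_eq_refl|exact: word_eq_sym].
by rewrite -{2}[v]inv_wordK; apply: word_eq_mulV.
Qed.

Definition pgroup_one : pgroup := \pi_pgroup [::].
Definition pgroup_mul (x y : pgroup) : pgroup := \pi_pgroup (repr x ++ repr y).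
Definition pgroup_inv (x : pgroup) : pgroup := \pi_pgroup (inv_word (repr x)).

Lemma pgroup_piM (v w : word I) :
  pgroup_mul (\pi v) (\pi w) = \pi_pgroup (v ++ w).
Proof. by apply/pgroupP; apply: word_eq_cat; apply: word_eq_repr. Qed.

Lemma pgroup_piV (v : word I) : pgroup_inv (\pi v) = \pi_pgroup (inv_word v).
Proof. by apply/pgroupP; apply: word_eq_inv; apply: word_eq_repr. Qed.

Lemma pgroup_mulA : associative pgroup_mul.
Proof.
by elim/quotW=> x; elim/quotW=> y; elim/quotW=> z; rewrite !pgroup_piM catA.
Qed.

Lemma pgroup_mul1 : left_id pgroup_one pgroup_mul.
Proof. by elim/quotW=> x; rewrite pgroup_piM. Qed.

Lemma pgroup_mulr1 : right_id pgroup_one pgroup_mul.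
Proof. by elim/quotW=> x; rewrite pgroup_piM cats0. Qed.

Lemma pgroup_mulrV : right_inverse pgroup_one pgroup_inv pgroup_mul.
Proof.
elim/quotW=> x; rewrite pgroup_piV pgroup_piM.
by apply/pgroupP; apply: word_eq_mulV.
Qed.

Lemma pgroup_mulV : left_inverse pgroup_one pgroup_inv pgroup_mul.
Proof.
elim/quotW=> x; rewrite pgroup_piV pgroup_piM -{2}[x]inv_wordK.
by apply/pgroupP; apply: word_eq_mulV.
Qed.

HB.instance Definition _ := isGroup.Build pgroup pgroup_mulA pgroup_mul1
  pgroup_mulr1 pgroup_mulV pgroup_mulrV.

Definition pgroup_gen (i : I) : pgroup := \pi_pgroup [:: (i, false)].

Lemma pgroupM (v w : word I) :
  (\pi_pgroup v * \pi_pgroup w)%g = \pi_pgroup (v ++ w).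
Proof. exact: pgroup_piM. Qed.

End PresentedGroup.

Inductive aterm (F I : Type) :=
| AGen of I
| ACst of F
| AAdd of aterm F I & aterm F I
| AMul of aterm F I & aterm F I.

Arguments AGen {F I}.
Arguments ACst {F I}.

HB.instance Definition _ (F I : Type) := gen_eqMixin (aterm F I).
HB.instance Definition _ (F I : Type) := gen_choiceMixin (aterm F I).

Fixpoint aterm_map (F I J : Type) (f : I -> J) (a : aterm F I) : aterm F J :=
  match a with
  | AGen i => AGen (f i)
  | ACst c => ACst c
  | AAdd a b => AAdd (aterm_map f a) (aterm_map f b)
  | AMul a b => AMul (aterm_map f a) (aterm_map f b)
  end.

Section PresentedAlgebra.
Variables (F : comPzRingType) (I : Type).
Local Notation term := (aterm F I).
Variable R : term -> term -> Prop.

(* The congruence generated by R and by the axioms of associative unital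
   F-algebras (ACst being the structure map). *)
Inductive aterm_eq : term -> term -> Prop :=
| aeq_refl a : aterm_eq a a
| aeq_sym a b : aterm_eq a b -> aterm_eq b a
| aeq_trans b a c : aterm_eq a b -> aterm_eq b c -> aterm_eq a c
| aeq_add a a' b b' :
    aterm_eq a a' -> aterm_eq b b' -> aterm_eq (AAdd a b) (AAdd a' b')
| aeq_mul a a' b b' :
    aterm_eq a a' -> aterm_eq b b' -> aterm_eq (AMul a b) (AMul a' b')
| aeq_addA a b c : aterm_eq (AAdd a (AAdd b c)) (AAdd (AAdd a b) c)
| aeq_addC a b : aterm_eq (AAdd a b) (AAdd b a)
| aeq_add0 a : aterm_eq (AAdd (ACst 0) a) a
| aeq_mulA a b c : aterm_eq (AMul a (AMul b c)) (AMul (AMul a b) c)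
| aeq_mul1 a : aterm_eq (AMul (ACst 1) a) a
| aeq_mul0 a : aterm_eq (AMul (ACst 0) a) (ACst 0)
| aeq_mulDl a b c :
    aterm_eq (AMul (AAdd a b) c) (AAdd (AMul a c) (AMul b c))
| aeq_mulDr a b c :
    aterm_eq (AMul a (AAdd b c)) (AAdd (AMul a b) (AMul a c))
| aeq_cstD c d : aterm_eq (ACst (c + d)) (AAdd (ACst c) (ACst d))
| aeq_cstM c d : aterm_eq (ACst (c * d)) (AMul (ACst c) (ACst d))
| aeq_cstC c a : aterm_eq (AMul (ACst c) a) (AMul a (ACst c))
| aeq_rel a b : R a b -> aterm_eq a b.

Definition aterm_eqb (a b : term) : bool := `[< aterm_eq a b >].

Lemma aterm_eqb_refl : reflexive aterm_eqb.
Proof. by move=> w; apply/asboolP; apply: aeq_refl. Qed.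

Lemma aterm_eqb_sym : ssrbool.symmetric aterm_eqb.
Proof. by move=> v w; apply/asboolP/asboolP; apply: aeq_sym. Qed.

Lemma aterm_eqb_trans : transitive aterm_eqb.
Proof.
by move=> v u w /asboolP uv /asboolP vw; apply/asboolP; apply: aeq_trans vw.
Qed.

Canonical aterm_equiv :=
  EquivRel aterm_eqb aterm_eqb_refl aterm_eqb_sym aterm_eqb_trans.

Definition palg := {eq_quot aterm_equiv}.

HB.instance Definition _ := Choice.on palg.
HB.instance Definition _ := EqQuotient.on palg.

Lemma palgP (a b : term) : aterm_eq a b <-> \pi_palg a = \pi_palg b.
Proof.
split=> [ab|]; first by apply/eqmodP/asboolP.
by move=> /eqmodP /asboolP.
Qed.

Lemma aterm_eq_repr (a : term) : aterm_eq (repr (\pi_palg a)) a.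
Proof. by apply/palgP; rewrite reprK. Qed.

Definition palg_add (x y : palg) : palg := \pi_palg (AAdd (repr x) (repr y)).
Definition palg_mul (x y : palg) : palg := \pi_palg (AMul (repr x) (repr y)).
Definition palg_scale (c : F) (x : palg) : palg := \pi_palg (AMul (ACst c) (repr x)).
Definition palg_opp (x : palg) : palg := palg_scale (-1) x.

Lemma palg_piD (a b : term) :
  palg_add (\pi a) (\pi b) = \pi_palg (AAdd a b).
Proof. by apply/palgP; apply: aeq_add; apply: aterm_eq_repr. Qed.

Lemma palg_piM (a b : term) :
  palg_mul (\pi a) (\pi b) = \pi_palg (AMul a b).
Proof. by apply/palgP; apply: aeq_mul; apply: aterm_eq_repr. Qed.

Lemma palg_piZ (c : F) (a : term) :
  palg_scale c (\pi a) = \pi_palg (AMul (ACst c) a).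
Proof.
by apply/palgP; apply: aeq_mul; [exact: aeq_refl|exact: aterm_eq_repr].
Qed.

Lemma palg_addA : associative palg_add.
Proof.
elim/quotW=> a; elim/quotW=> b; elim/quotW=> c; rewrite !palg_piD.
by apply/palgP; apply: aeq_addA.
Qed.

Lemma palg_addC : commutative palg_add.
Proof.
elim/quotW=> a; elim/quotW=> b; rewrite !palg_piD.
by apply/palgP; apply: aeq_addC.
Qed.

Lemma palg_add0 : left_id (\pi_palg (ACst 0)) palg_add.
Proof. by elim/quotW=> a; rewrite palg_piD; apply/palgP; apply: aeq_add0. Qed.

Lemma palg_mulA : associative palg_mul.
Proof.
elim/quotW=> a; elim/quotW=> b; elim/quotW=> c; rewrite !palg_piM.
by apply/palgP; apply: aeq_mulA.
Qed.

Lemma palg_mul1 : left_id (\pi_palg (ACst 1)) palg_mul.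
Proof. by elim/quotW=> a; rewrite palg_piM; apply/palgP; apply: aeq_mul1. Qed.

Lemma palg_mulr1 : right_id (\pi_palg (ACst 1)) palg_mul.
Proof.
elim/quotW=> a; rewrite palg_piM; apply/palgP.
by apply: aeq_trans (aeq_mul1 a); apply: aeq_sym; apply: aeq_cstC.
Qed.

Lemma palg_mulDl : left_distributive palg_mul palg_add.
Proof.
elim/quotW=> a; elim/quotW=> b; elim/quotW=> c.
by rewrite !(palg_piD, palg_piM); apply/palgP; apply: aeq_mulDl.
Qed.

Lemma palg_mulDr : right_distributive palg_mul palg_add.
Proof.
elim/quotW=> a; elim/quotW=> b; elim/quotW=> c.
by rewrite !(palg_piD, palg_piM); apply/palgP; apply: aeq_mulDr.
Qed.

Lemma palg_scaleE c x : palg_scale c x = palg_mul (\pi_palg (ACst c)) x.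
Proof. by elim/quotW: x => a; rewrite palg_piZ palg_piM. Qed.

Lemma palg_cstD c d :
  \pi_palg (ACst (c + d)) = palg_add (\pi_palg (ACst c)) (\pi_palg (ACst d)).
Proof. by rewrite palg_piD; apply/palgP; apply: aeq_cstD. Qed.

Lemma palg_cstM c d :
  \pi_palg (ACst (c * d)) = palg_mul (\pi_palg (ACst c)) (\pi_palg (ACst d)).
Proof. by rewrite palg_piM; apply/palgP; apply: aeq_cstM. Qed.

Lemma palg_cstC c x :
  palg_mul (\pi_palg (ACst c)) x = palg_mul x (\pi_palg (ACst c)).
Proof.
by elim/quotW: x => a; rewrite !palg_piM; apply/palgP; apply: aeq_cstC.
Qed.

Lemma palg_0M x : palg_mul (\pi_palg (ACst 0)) x = \pi_palg (ACst 0).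
Proof. by elim/quotW: x => a; rewrite palg_piM; apply/palgP; apply: aeq_mul0. Qed.

Lemma palg_addN : left_inverse (\pi_palg (ACst 0)) palg_opp palg_add.
Proof.
move=> x; rewrite /palg_opp palg_scaleE -{2}[x]palg_mul1 -palg_mulDl -palg_cstD.
by rewrite addNr palg_0M.
Qed.

HB.instance Definition _ := GRing.isPzRing.Build palg palg_addA palg_addC
  palg_add0 palg_addN palg_mulA palg_mul1 palg_mulr1 palg_mulDl palg_mulDr.

Lemma palg_scaleA c d x : palg_scale c (palg_scale d x) = palg_scale (c * d) x.
Proof. by rewrite !palg_scaleE palg_cstM -palg_mulA. Qed.

Lemma palg_scale1 : left_id 1 palg_scale.
Proof. by move=> x; rewrite palg_scaleE palg_mul1. Qed.

Lemma palg_scaleDr : right_distributive palg_scale +%R.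
Proof. by move=> c x y; rewrite !palg_scaleE; apply: palg_mulDr. Qed.

Lemma palg_scaleDl x : {morph palg_scale^~ x : c d / c + d}.
Proof. by move=> c d; rewrite !palg_scaleE palg_cstD; apply: palg_mulDl. Qed.

HB.instance Definition _ := GRing.Zmodule_isLmodule.Build F palg palg_scaleA
  palg_scale1 palg_scaleDr palg_scaleDl.

Definition palg_gen (i : I) : palg := \pi_palg (AGen i).

Lemma palgD (a b : term) : \pi_palg a + \pi_palg b = \pi_palg (AAdd a b).
Proof. exact: palg_piD. Qed.

Lemma palgM (a b : term) : \pi_palg a * \pi_palg b = \pi_palg (AMul a b).
Proof. exact: palg_piM. Qed.

Lemma palgZ (c : F) (a : term) :
  c *: \pi_palg a = \pi_palg (AMul (ACst c) a).
Proof. exact: palg_piZ. Qed.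

Lemma palg_cst (c : F) : \pi_palg (ACst c) = c *: (1 : palg).
Proof. by rewrite -[LHS]palg_mulr1 -palg_scaleE. Qed.

(* The structure library reserves algType for nonzero algebras; palg may be the
   zero ring, so its ring and module structures are related by hand. *)
Lemma palg_scalerAl (c : F) (x y : palg) : c *: (x * y) = c *: x * y.
Proof.
rewrite [LHS]palg_scaleE [X in _ = X * _]palg_scaleE; exact: palg_mulA.
Qed.

Lemma palg_scalerAr (c : F) (x y : palg) : c *: (x * y) = x * (c *: y).
Proof.
rewrite [LHS]palg_scaleE [X in _ = _ * X]palg_scaleE.
rewrite (palg_cstC c y); rewrite palg_cstC; apply: esym; exact: palg_mulA.
Qed.

End PresentedAlgebra.

Section PresentedAlgebraMap.
Variables (F : comPzRingType) (I J : Type) (f : I -> J).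
Variables (R : aterm F I -> aterm F I -> Prop) (S : aterm F J -> aterm F J -> Prop).

(* The homomorphism induced by a map of generators under which the relations R
   become consequences of S (see palg_map_pi). *)
Definition palg_map (x : palg R) : palg S := \pi_(palg S) (aterm_map f (repr x)).

Hypothesis fR : forall a b, R a b -> aterm_eq S (aterm_map f a) (aterm_map f b).

Lemma aterm_map_eq a b :
  aterm_eq R a b -> aterm_eq S (aterm_map f a) (aterm_map f b).
Proof.
elim=> /=.
- by move=> *; apply: aeq_refl.
- by move=> *; apply: aeq_sym.
- by move=> {}b {}a c _ ab _; apply: aeq_trans.
- by move=> *; apply: aeq_add.
- by move=> *; apply: aeq_mul.
- by move=> *; apply: aeq_addA.
- by move=> *; apply: aeq_addC.
- by move=> *; apply: aeq_add0.
- by move=> *; apply: aeq_mulA.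
- by move=> *; apply: aeq_mul1.
- by move=> *; apply: aeq_mul0.
- by move=> *; apply: aeq_mulDl.
- by move=> *; apply: aeq_mulDr.
- by move=> *; apply: aeq_cstD.
- by move=> *; apply: aeq_cstM.
- by move=> *; apply: aeq_cstC.
- exact: fR.
Qed.

Lemma palg_map_pi a : palg_map (\pi a) = \pi_(palg S) (aterm_map f a).
Proof. by apply/palgP; apply: aterm_map_eq; apply: aterm_eq_repr. Qed.

Lemma palg_mapD : {morph palg_map : x y / x + y}.
Proof.
by elim/quotW=> a; elim/quotW=> b; rewrite palgD !palg_map_pi palgD.
Qed.

Lemma palg_mapM : {morph palg_map : x y / x * y}.
Proof.
by elim/quotW=> a; elim/quotW=> b; rewrite palgM !palg_map_pi palgM.
Qed.

Lemma palg_mapZ c : {morph palg_map : x / c *: x}.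
Proof. by elim/quotW=> a; rewrite palgZ !palg_map_pi palgZ. Qed.

Lemma palg_map1 : palg_map 1 = 1.
Proof. exact: palg_map_pi. Qed.

Lemma palg_map_gen i : palg_map (palg_gen R i) = palg_gen S (f i).
Proof. exact: palg_map_pi. Qed.

End PresentedAlgebraMap.

(* Relations between positive words on generators numbered by idx. *)
Inductive braid_rel (I : Type) (idx : I -> nat) : seq I -> seq I -> Prop :=
| brel_quad i j : idx i = 0%N -> idx j = 1%N ->
    braid_rel idx [:: i; j; i; j] [:: j; i; j; i]
| brel_comm i j : ((idx i).+1 < idx j)%N ->
    braid_rel idx [:: i; j] [:: j; i]
| brel_triple i j : (0 < idx i)%N -> idx j = (idx i).+1 ->
    braid_rel idx [:: i; j; i] [:: j; i; j].

Definition aff_braid_rel (n : nat) (v w : word 'I_n) : Prop :=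
  exists2 s : seq 'I_n * seq 'I_n,
    braid_rel (@nat_of_ord n) s.1 s.2 & v = pos_word s.1 /\ w = pos_word s.2.

(* The affine braid group B_aff,n; the usual braid group B_n is its subgroup
   generated by braid_gen i for 0 < i < n. *)
Definition aff_braid (n : nat) := pgroup (@aff_braid_rel n).

Definition braid_gen (n : nat) (i : 'I_n) : aff_braid n :=
  pgroup_gen (@aff_braid_rel n) i.

Definition exponent_sum (n : nat) (P : pred nat) (w : word 'I_n) : int :=
  \sum_(x <- w | P x.1) (if x.2 then -1 else 1).

(* Exponent sums do not depend on the representative: see writhe_pi and
   writhe0_pi. *)
Definition writhe (n : nat) (alpha : aff_braid n) : int :=
  exponent_sum (fun i => 0 < i)%N (repr alpha).

Definition writhe0 (n : nat) (alpha : aff_braid n) : int :=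
  exponent_sum (fun i => i == 0)%N (repr alpha).

Definition delete_t0 (n : nat) (alpha : aff_braid n) : aff_braid n :=
  \pi_(aff_braid n) [seq x : 'I_n * bool <- repr alpha | (0 < x.1)%N].

Lemma exponent_sum_cat n (P : pred nat) (v w : word 'I_n) :
  exponent_sum P (v ++ w) = exponent_sum P v + exponent_sum P w.
Proof. exact: big_cat. Qed.

Section BraidMorphisms.
Variable n : nat.
Local Notation B := (aff_braid n).
Local Notation weq := (word_eq (@aff_braid_rel n)).

Lemma exponent_sum_eq (P : pred nat) (v w : word 'I_n) :
  (forall i j, (0 < i)%N -> (0 < j)%N -> P i = P j) -> weq v w ->
  exponent_sum P v = exponent_sum P w.
Proof.
move=> P_pos; elim=> {v w} //.
- by move=> v u w _ -> _ ->.
- by move=> v v' w w' _ vv' _ ww'; rewrite !exponent_sum_cat vv' ww'.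
- move=> i b; rewrite /exponent_sum !big_cons big_nil /=.
  by case: (P i) b => -[]; rewrite //= addr0.
move=> _ _ [[s s'] /= ss' [-> ->]].
case: ss' => i j; rewrite /exponent_sum /pos_word /= !big_cons !big_nil /=.
- by move=> -> ->; case: (P 0%N); case: (P 1%N).
- by case: (P i); case: (P j).
- by move=> i0 ij; rewrite (P_pos i j) // ij.
Qed.

Lemma writhe_pi w :
  writhe (\pi_B w) = exponent_sum (fun i => 0 < i)%N w.
Proof.
apply: (@exponent_sum_eq (fun i => (0 < i)%N)) => [i j -> ->//|].
exact: word_eq_repr.
Qed.

Lemma writhe0_pi w :
  writhe0 (\pi_B w) = exponent_sum (fun i => i == 0)%N w.
Proof.
apply: (@exponent_sum_eq (fun i => i == 0)) => [[|i] [|j]//|].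
exact: word_eq_repr.
Qed.

Lemma writheM (a b : B) : writhe (a * b)%g = writhe a + writhe b.
Proof.
elim/quotW: a => v; elim/quotW: b => w.
by rewrite pgroupM !writhe_pi exponent_sum_cat.
Qed.

Lemma writhe0M (a b : B) : writhe0 (a * b)%g = writhe0 a + writhe0 b.
Proof.
elim/quotW: a => v; elim/quotW: b => w.
by rewrite pgroupM !writhe0_pi exponent_sum_cat.
Qed.

Lemma writhe_gen (i : 'I_n) : writhe (braid_gen i) = (0 < i)%N%:Z.
Proof.
by rewrite writhe_pi /exponent_sum big_cons big_nil /=; case: (0 < i)%N.
Qed.

Lemma writhe0_gen (i : 'I_n) : writhe0 (braid_gen i) = (i == 0 :> nat)%N%:Z.
Proof.
by rewrite writhe0_pi /exponent_sum big_cons big_nil /=; case: (_ == _).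
Qed.

Lemma delete_t0_eq (v w : word 'I_n) : weq v w ->
  weq [seq x : 'I_n * bool <- v | (0 < x.1)%N]
      [seq x : 'I_n * bool <- w | (0 < x.1)%N].
Proof.
elim=> {v w}.
- by move=> w; apply: word_eq_refl.
- by move=> v w _; apply: word_eq_sym.
- by move=> v u w _ uv _; apply: word_eq_trans.
- by move=> v v' w w' _ vv' _ ww'; rewrite !filter_cat; apply: word_eq_cat.
- move=> i b /=; case: (0 < i)%N; last exact: word_eq_refl.
  exact: (word_eq_cancel (@aff_braid_rel n)).
move=> _ _ [[s s'] /= ss' [-> ->]]; case: ss' => i j /=.
- by move=> -> -> /=; apply: word_eq_refl.
- case: (posnP i) => [->|i0] ij; have -> /= : (0 < j)%N by apply: leq_trans ij.
    exact: word_eq_refl.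
  by apply: word_eq_rel; exists ([:: i; j], [:: j; i]) => //; constructor.
- move=> i0 ij; rewrite i0 ij /=.
  by apply: word_eq_rel; exists ([:: i; j; i], [:: j; i; j]) => //; constructor.
Qed.

Lemma delete_t0_pi w :
  delete_t0 (\pi_B w) = \pi_B [seq x : 'I_n * bool <- w | (0 < x.1)%N].
Proof. by apply/pgroupP; apply: delete_t0_eq; apply: word_eq_repr. Qed.

Lemma delete_t0M (a b : B) :
  delete_t0 (a * b)%g = (delete_t0 a * delete_t0 b)%g.
Proof.
elim/quotW: a => v; elim/quotW: b => w.
by rewrite pgroupM !delete_t0_pi pgroupM filter_cat.
Qed.

Lemma delete_t0_gen (i : 'I_n) :
  delete_t0 (braid_gen i) = if (0 < i)%N then braid_gen i else 1%g.
Proof. by rewrite delete_t0_pi /=; case: ifP. Qed.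

End BraidMorphisms.

(* The two-sided inverse of x if x is invertible, and 0 otherwise. *)
Definition ring_inv (A : pzRingType) (x : A) : A :=
  xget 0 [set y | x * y = 1 /\ y * x = 1]%classic.

Lemma ring_invE (A : pzRingType) (x y : A) :
  x * y = 1 -> y * x = 1 -> ring_inv x = y.
Proof.
move=> xy yx; rewrite /ring_inv; case: xgetP => [z _ [xz _]|/(_ y)[]//].
by rewrite -[z]mul1r -yx -mulrA xz mulr1.
Qed.

Definition word_val (A : pzRingType) (I : Type) (g : I -> A) (w : word I) : A :=
  \prod_(x <- w) (if x.2 then ring_inv (g x.1) else g x.1).

Section WordVal.
Variables (A : pzRingType) (n : nat) (g : 'I_n -> A).
Hypothesis g_inv : forall i, exists2 y, g i * y = 1 & y * g i = 1.
Hypothesis g_braid : forall s s', braid_rel (@nat_of_ord n) s s' ->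
  \prod_(i <- s) g i = \prod_(i <- s') g i.

Lemma word_val_cat (v w : word 'I_n) :
  word_val g (v ++ w) = word_val g v * word_val g w.
Proof. exact: big_cat. Qed.

Lemma word_val_pos (s : seq 'I_n) :
  word_val g (pos_word s) = \prod_(i <- s) g i.
Proof. by rewrite /word_val big_map. Qed.

Lemma word_val_eq (v w : word 'I_n) :
  word_eq (@aff_braid_rel n) v w -> word_val g v = word_val g w.
Proof.
elim=> {v w} //.
- by move=> v u w _ -> _ ->.
- by move=> v v' w w' _ vv' _ ww'; rewrite !word_val_cat vv' ww'.
- move=> i b; rewrite /word_val !big_cons big_nil mulr1 /=.
  have [y gy yg] := g_inv i.
  by case: b; rewrite /= (ring_invE gy yg).
by move=> _ _ [[s s'] /= ss' [-> ->]]; rewrite !word_val_pos (g_braid ss').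
Qed.

End WordVal.

Section ArikiKoike.
Variables (F : fieldType) (e : nat) (q : F) (u : 'I_e -> F).

Definition aterm_word (I : Type) (s : seq I) : aterm F I :=
  foldr (fun i a => AMul (AGen i) a) (ACst 1) s.

Inductive AK_rel (I : Type) (idx : I -> nat) : aterm F I -> aterm F I -> Prop :=
| AK_cyclotomic i : idx i = 0%N ->
    AK_rel idx
      (\big[@AMul F I/ACst 1]_(p < e) AAdd (AGen i) (ACst (- u p))) (ACst 0)
| AK_quadratic i : (0 < idx i)%N ->
    AK_rel idx
      (AMul (AAdd (AGen i) (ACst (- q))) (AAdd (AGen i) (ACst 1))) (ACst 0)
| AK_braid s s' : braid_rel idx s s' ->
    AK_rel idx (aterm_word s) (aterm_word s').

Definition AKn (n : nat) := palg (AK_rel (@nat_of_ord n)).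

(* H_e: the direct limit of the algebras AKn n along T_i |-> T_i is the algebra
   with all the generators T_0, T_1, ... and all the relations. *)
Definition AK := palg (AK_rel (@id nat)).

Definition AKnT (n : nat) (i : 'I_n) : AKn n :=
  palg_gen (AK_rel (@nat_of_ord n)) i.

Definition AKT (i : nat) : AK := palg_gen (AK_rel (@id nat)) i.

Definition AKn_incl (n : nat) (h : AKn n) : AK :=
  palg_map (@nat_of_ord n) (AK_rel (@id nat)) h.

Definition braid_AK (n : nat) (alpha : aff_braid n) : AKn n :=
  word_val (@AKnT n) (repr alpha).

Lemma aterm_map_word I J (f : I -> J) (s : seq I) :
  aterm_map f (aterm_word s) = aterm_word (map f s).
Proof. by elim: s => //= i s ->. Qed.

Lemma AK_rel_map (n : nat) (a b : aterm F 'I_n) :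
  AK_rel (@nat_of_ord n) a b ->
  aterm_eq (AK_rel (@id nat)) (aterm_map (@nat_of_ord n) a)
    (aterm_map (@nat_of_ord n) b).
Proof.
move=> ab; apply: aeq_rel; case: ab => /=.
- move=> i i0; rewrite (big_morph (aterm_map (@nat_of_ord n))
    (id1 := ACst 1) (op1 := @AMul F nat)) //=.
  exact: AK_cyclotomic.
- by move=> i i0; apply: AK_quadratic.
move=> s s' ss'; rewrite !aterm_map_word; apply: AK_braid.
by case: ss' => i j /=; constructor.
Qed.

Section Inclusion.
Variable n : nat.

Lemma AKn_inclD : {morph @AKn_incl n : x y / x + y}.
Proof. exact: palg_mapD (@AK_rel_map n). Qed.

Lemma AKn_inclM : {morph @AKn_incl n : x y / x * y}.
Proof. exact: palg_mapM (@AK_rel_map n). Qed.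

Lemma AKn_inclZ c : {morph @AKn_incl n : x / c *: x}.
Proof. exact: palg_mapZ (@AK_rel_map n) c. Qed.

Lemma AKn_incl1 : AKn_incl (1 : AKn n) = 1.
Proof. exact: palg_map1 (@AK_rel_map n). Qed.

Lemma AKn_incl_gen (i : 'I_n) : AKn_incl (AKnT i) = AKT i.
Proof. exact: palg_map_gen (@AK_rel_map n) i. Qed.

End Inclusion.

Lemma AKn_incl_surj (x : AK) : exists n (h : AKn n), AKn_incl h = x.
Proof.
elim/quotW: x => a.
pose bnd := fix bnd (a : aterm F nat) : nat := match a with
  | AGen i => i.+1 | ACst _ => 0%N
  | AAdd a b => maxn (bnd a) (bnd b) | AMul a b => maxn (bnd a) (bnd b) end.
suff H m : (bnd a <= m)%N ->
    exists b : aterm F 'I_m, aterm_map (@nat_of_ord m) b = a.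
  have [b <-] := H _ (leqnn _).
  by exists (bnd a), (\pi_(AKn (bnd a)) b); apply: palg_map_pi (@AK_rel_map _) b.
elim: a => [i|c|a IHa b IHb|a IHa b IHb] /=.
- by move=> im; exists (AGen (Ordinal im)).
- by exists (ACst c).
- rewrite geq_max => /andP[/IHa[a' <-] /IHb[b' <-]].
  by exists (AAdd a' b').
- rewrite geq_max => /andP[/IHa[a' <-] /IHb[b' <-]].
  by exists (AMul a' b').
Qed.

Section Generators.
Variables (I : Type) (idx : I -> nat).
Local Notation H := (palg (AK_rel idx)).
Local Notation T i := (palg_gen (AK_rel idx) i).

Lemma palg_big (r : seq 'I_e) (f : 'I_e -> aterm F I) :
  \pi_H (\big[@AMul F I/ACst 1]_(p <- r) f p) = \prod_(p <- r) \pi_H (f p).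
Proof.
elim: r => [|p r IH]; rewrite (big_nil, big_cons) ?big_nil // big_cons.
by rewrite -palgM IH.
Qed.

Lemma AK_cyclotomicE i : idx i = 0%N -> \prod_(p < e) (T i - u p *: (1 : H)) = 0.
Proof.
move=> i0.
have /palgP := aeq_rel (AK_cyclotomic i0); rewrite palg_big => E.
rewrite -[RHS]E.
by apply: eq_bigr => p _; rewrite -palgD palg_cst scaleNr.
Qed.

Lemma AK_quadraticE i :
  (0 < idx i)%N -> (T i - q *: (1 : H)) * (T i + 1) = 0.
Proof.
move=> i0; have /palgP := aeq_rel (AK_quadratic i0).
by rewrite -palgM -!palgD !palg_cst scaleNr scale1r scale0r.
Qed.

Lemma AK_braidE s s' : braid_rel idx s s' ->
  \prod_(i <- s) T i = \prod_(i <- s') T i.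
Proof.
have E r : \pi_H (aterm_word r) = \prod_(i <- r) T i.
  by elim: r => [|i r IH]; rewrite (big_nil, big_cons) //= -palgM IH.
by move=> ss'; rewrite -!E; apply/palgP; apply: aeq_rel; apply: AK_braid.
Qed.

Hypothesis q_neq0 : q != 0.
Hypothesis u_neq0 : forall p, u p != 0.

Lemma AK_gen_inv i : exists2 y : H, T i * y = 1 & y * T i = 1.
Proof.
suff [Q [d d0 [TQ QT]]] :
    exists (Q : H), exists2 d : F, d != 0 &
      T i * Q = d *: (1 : H) /\ Q * T i = d *: (1 : H).
  exists (d^-1 *: Q).
    by rewrite -palg_scalerAr TQ scalerA mulVf // scale1r.
  by rewrite -palg_scalerAl QT scalerA mulVf // scale1r.
have [i0|i_gt0] := posnP (idx i); last first.
  have H0 := AK_quadraticE i_gt0.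
  exists (T i + (1 - q) *: (1 : H)), q => //; split.
    rewrite mulrDr -palg_scalerAr mulr1; apply/eqP; rewrite -subr_eq0; apply/eqP.
    rewrite -[RHS]H0 mulrDr mulr1 mulrBl -palg_scalerAl mul1r scalerBl scale1r.
    by rewrite -!addrA; congr (_ + _); rewrite addrCA !addrA.
  rewrite mulrDl -palg_scalerAl mul1r; apply/eqP; rewrite -subr_eq0; apply/eqP.
  rewrite -[RHS]H0 mulrDr mulr1 mulrBl -palg_scalerAl mul1r scalerBl scale1r.
  by rewrite -!addrA; congr (_ + _); rewrite addrCA !addrA.
have P (r : seq 'I_e) : exists (Q : H), exists2 d : F, d != 0 &
    T i * Q = Q * T i /\
    \prod_(p <- r) (T i - u p *: (1 : H)) = T i * Q + d *: (1 : H).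
  elim: r => [|p r [Q [d d0 [TQ E]]]].
    by exists 0, 1; rewrite ?oner_neq0 // big_nil mulr0 mul0r add0r scale1r.
  exists (T i * Q + d *: (1 : H) - u p *: Q), (- u p * d).
    by rewrite mulf_neq0 ?oppr_eq0.
  split.
    rewrite mulrBr mulrDr mulrBl mulrDl -!palg_scalerAr -!palg_scalerAl.
    by rewrite mulr1 mul1r -mulrA -TQ.
  rewrite big_cons E mulrBl mulrDr !mulrBr mulrDr -!palg_scalerAr -!palg_scalerAl.
  rewrite !mul1r mulrDr -palg_scalerAr !mulr1 scalerA (mulrC d) mulNr scaleNr.
  by rewrite opprD !addrA.
have [Q [d d0 [TQ E]]] := P (index_enum 'I_e).
move: E; rewrite (AK_cyclotomicE i0) => E; exists (- Q), d => //.
have {}E : T i * Q = - (d *: (1 : H)).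
  by apply/eqP; rewrite -subr_eq0 opprK -E.
by rewrite mulrN mulNr -TQ E opprK.
Qed.

End Generators.

Section BraidRepresentation.
Variable n : nat.
Hypothesis q_neq0 : q != 0.
Hypothesis u_neq0 : forall p, u p != 0.

Lemma braid_AK_pi w : braid_AK (\pi_(aff_braid n) w) = word_val (@AKnT n) w.
Proof.
apply: word_val_eq (word_eq_repr _ _); first exact: AK_gen_inv.
exact: AK_braidE.
Qed.

Lemma braid_AKM (a b : aff_braid n) :
  braid_AK (a * b)%g = braid_AK a * braid_AK b.
Proof.
elim/quotW: a => v; elim/quotW: b => w.
by rewrite pgroupM !braid_AK_pi word_val_cat.
Qed.

Lemma braid_AK1 : braid_AK (1%g : aff_braid n) = 1.
Proof. by rewrite [LHS]braid_AK_pi /word_val big_nil. Qed.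

Lemma braid_AK_gen (i : 'I_n) : braid_AK (braid_gen i) = AKnT i.
Proof. by rewrite braid_AK_pi /word_val big_cons big_nil mulr1. Qed.

End BraidRepresentation.

Fixpoint AKL (i : nat) : AK :=
  if i is j.+1 then AKT i * AKL j * ring_inv (AKT i) else AKT 0.

(* Only y 1, ..., y (e - 1) matter. *)
Definition is_markov_trace (z : F) (y : nat -> F) (tau : {scalar AK}) : Prop :=
  [/\ tau 1 = 1,
      forall h h' : AK, tau (h * h') = tau (h' * h),
      forall (n : nat) (h : AKn n), (1 <= n)%N ->
        tau (AKn_incl h * AKT n) = z * tau (AKn_incl h)
    & forall (n j : nat) (h : AKn n), (1 <= j <= e.-1)%N ->
        tau (AKn_incl h * AKL n ^+ j) = y j * tau (AKn_incl h)].

End ArikiKoike.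

Section RationalFunctions.
Variables (K E : fieldType) (iota : {rmorphism K -> E}).

(* The value at a of a rational function over K, the coefficients being sent to
   E by iota; by convention it is 0 if there is a pole at a. *)
Definition ratfun_eval (a : E) (f : {fraction {poly K}}) : E :=
  xget 0 [set v | exists P D : {poly K},
    [/\ (map_poly iota D).[a] != 0, f = tofrac P / tofrac D
      & v = (map_poly iota P).[a] / (map_poly iota D).[a]]]%classic.

Lemma ratfun_evalE (a : E) (P D : {poly K}) :
  (map_poly iota D).[a] != 0 ->
  ratfun_eval a (tofrac P / tofrac D) =
    (map_poly iota P).[a] / (map_poly iota D).[a].
Proof.
have frac_neq0 (G : {poly K}) :
    (map_poly iota G).[a] != 0 -> tofrac G != 0 :> {fraction {poly K}}.
  apply: contraNneq => /eqP; rewrite tofrac_eq0 => /eqP ->.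
  by rewrite rmorph0 horner0.
move=> Da; rewrite /ratfun_eval; case: xgetP => [v _|nov]; last first.
  by case: (nov ((map_poly iota P).[a] / (map_poly iota D).[a])); exists P, D.
case=> P' [D' [D'a /eqP + ->]].
rewrite eqr_div ?frac_neq0 // -!tofracM tofrac_eq => /eqP PD.
apply/eqP; rewrite eqr_div // -!hornerM -!rmorphM /=.
by rewrite PD.
Qed.

End RationalFunctions.

Section Alexander.
Variables (K : fieldType) (e : nat) (q : K) (u : 'I_e -> K).

(* K(t^(1/2)); the indeterminate is t^(1/2). *)
Local Notation Kt := {fraction {poly K}}.

Definition ratfun_cst (c : K) : Kt := tofrac c%:P.
Definition sqrt_t : Kt := tofrac 'X.
Definition var_t : Kt := sqrt_t ^+ 2.

Definition trace_z : Kt := - ((1 - ratfun_cst q) / (1 - var_t * ratfun_cst q)).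

Definition AKt : Type := AK (ratfun_cst q) (fun p => ratfun_cst (u p)).

(* The parameters y_j are constants of K: they do not depend on t. *)
Definition is_AKt_trace (y : nat -> K) (tau : {scalar AKt}) : Prop :=
  is_markov_trace trace_z (fun j => ratfun_cst (y j)) tau.

Definition link_invariant (tau : {scalar AKt}) (n : nat) (alpha : aff_braid n) : Kt :=
  (- ((1 - var_t * ratfun_cst q) / (sqrt_t * (1 - ratfun_cst q)))) ^+ n.-1
  * sqrt_t ^ writhe alpha
  * tau (AKn_incl (braid_AK (ratfun_cst q) (fun p => ratfun_cst (u p)) alpha)).

(* The value lies in K(q^(1/2)): r is a square root of q in an extension
   iota : K -> E. *)
Definition alexander_G (E : fieldType) (iota : {rmorphism K -> E}) (r : E)
    (tau : {scalar AKt}) (n : nat) (alpha : aff_braid n) : E :=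
  ratfun_eval iota r^-1 (link_invariant tau alpha).

End Alexander.

(* With e = 1 and u_1 = 1 one has T_0 = 1: AKt is then the Iwahori-Hecke algebra
   of type A, and alexander_G the usual Alexander polynomial. *)
Definition u_typeA (K : fieldType) : 'I_1 -> K := fun=> 1.

Definition base_field (e : nat) := {fraction {mpoly rat[e.+1]}}.

Definition base_q (e : nat) : base_field e :=
  tofrac ('X_ord0 : {mpoly rat[e.+1]}).

Definition base_u (e : nat) (p : 'I_e) : base_field e :=
  tofrac ('X_(lift ord0 p) : {mpoly rat[e.+1]}).

Definition base_sigma (e d : nat) : base_field e :=
  (mesym e (base_field e) d).@[@base_u e].

Definition weight_C (e : nat) (y : nat -> base_field e) (p : 'I_e) : base_field e :=
  \sum_(1 <= i < e) (base_u p ^+ (e - i - 1) *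
    \sum_(1 <= j < i.+1) (-1) ^+ (i - j) * y j * base_sigma e (i - j))
  + (-1) ^+ (e - 1) * \prod_(l < e | l != p) base_u l.

(* Main.v *)
Require Import Defs.
From mathcomp Require Import all_boot all_order all_algebra.
From mathcomp Require Import ring mpoly.

Import GRing.Theory.
Local Open Scope ring_scope.

Set Implicit Arguments.
Unset Strict Implicit.
Unset Printing Implicit Defensive.

(* At t^(1/2) = q^(-1/2) the normalising factor lam = 1 / (z t^(1/2)) vanishes
   while lam z = t^(-1/2) stays invertible.  Let O be the ring of functions of
   t^(1/2) regular at that point.  The O-subalgebra of H_{e,n+1} generated by
   T_0, ..., T_n is spanned by the elements a T_n b (n >= 1) and a L_n^j b (j < e), a,
   b in the previous one, so modulo functions vanishing at that point the
   functional lam^n tau is determined by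
     lam^n tau (a T_n b) = t^(-1/2) lam^(n-1) tau (b a),   lam^n tau (a L_n^j b) = 0,
   and by the values tau (T_0^j), j < e.  For each p there is a homomorphism f_p
   to the type A algebra with T_0 |-> u_p and T_i |-> T_i; it sends L_n to the
   scalar u_p, so every combination sum_p c_p lam^n tauA (f_p x) obeys the same
   two rules.  Hence it agrees with lam^n tau as soon as sum_p c_p u_p^j = y_j
   for j < e (with y_0 = 1), a system which Lagrange interpolation solves by
   c_p = C(e,p) / prod_(l != p) (u_p - u_l). *)

(** * Finite sums of elements of a given set *)

Section AdditiveClosure.
Variable A : pzRingType.

Inductive sums_of (G : A -> Prop) : A -> Prop :=
| sums_0 : sums_of G 0
| sums_gen x : G x -> sums_of G x
| sums_add x y : sums_of G x -> sums_of G y -> sums_of G (x + y).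

(** Serves with [f] a left or right multiplication, to show that a span is stable under it, and with
    [f] the identity, to pass from one spanning set to another. *)
Lemma sums_morph (G G' : A -> Prop) (f : A -> A) :
  {morph f : x y / x + y} -> (forall x, G x -> sums_of G' (f x)) ->
  forall x, sums_of G x -> sums_of G' (f x).
Proof.
move=> fD fG x; elim=> {x} [|x /fG //|x y _ Hx _ Hy].
  suff -> : f 0 = 0 by apply: sums_0.
  by apply: (addrI (f 0)); rewrite -fD !addr0.
by rewrite fD; apply: sums_add.
Qed.

End AdditiveClosure.

(** * Spanning sets for the subalgebra of [T_0, ..., T_n] over that of [T_0, ..., T_{n-1}], in an
    abstract ring with central scalars [C] *)

Section CyclotomicSpanning.
Variables (A : pzRingType) (C : A -> Prop) (T Ti L J : nat -> A) (q qi : A) (e : nat).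
Hypothesis C_central : forall c x, C c -> c * x = x * c.
Hypotheses (C_1 : C 1) (C_N1 : C (-1)) (C_q : C q) (C_qi : C qi).
Hypothesis qi_q : qi * q = 1.
Hypothesis T_sq : forall i, T i.+1 * T i.+1 = (q - 1) * T i.+1 + q.
Hypotheses (T_Ti : forall i, T i.+1 * Ti i.+1 = 1)
           (Ti_T : forall i, Ti i.+1 * T i.+1 = 1).
Hypothesis T_comm : forall i j, (i.+1 < j)%N -> T i * T j = T j * T i.
Hypothesis T_braid : forall i,
  T i.+1 * T i.+2 * T i.+1 = T i.+2 * T i.+1 * T i.+2.
Hypothesis T_quad : T 0%N * T 1%N * T 0%N * T 1%N = T 1%N * T 0%N * T 1%N * T 0%N.
Hypothesis L0 : L 0%N = T 0%N.
Hypothesis LS : forall n, L n.+1 = T n.+1 * L n * Ti n.+1.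
Hypothesis J0 : J 0%N = T 0%N.
Hypothesis JS : forall n, J n.+1 = T n.+1 * J n * T n.+1.
Hypothesis e_gt0 : (0 < e)%N.

Inductive gen_sub (n : nat) : A -> Prop :=
| gen_sub_cst c : C c -> gen_sub n c
| gen_sub_T i : (i < n)%N -> gen_sub n (T i)
| gen_sub_add x y : gen_sub n x -> gen_sub n y -> gen_sub n (x + y)
| gen_sub_mul x y : gen_sub n x -> gen_sub n y -> gen_sub n (x * y).

(** [gen_sub 0] contains no generator, so its elements are central coefficients, and [T0_pow] is the
    cyclotomic relation solved for the highest power of [T_0]. *)
Inductive low_power (k : nat) : A -> Prop :=
| low_power_mon j a : (j < k)%N -> gen_sub 0 a -> low_power k (a * T 0%N ^+ j).

Hypothesis T0_pow : sums_of (low_power e) (T 0%N ^+ e).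

Let gs1 n : gen_sub n 1. Proof. exact: gen_sub_cst. Qed.
Let gsq n : gen_sub n q. Proof. exact: gen_sub_cst. Qed.
Let gsqi n : gen_sub n qi. Proof. exact: gen_sub_cst. Qed.

Let gsN n x : gen_sub n x -> gen_sub n (- x).
Proof. by move=> Hx; rewrite -mulN1r; apply: gen_sub_mul => //; apply: gen_sub_cst. Qed.

Let gs0 n : gen_sub n 0.
Proof. by rewrite -(subrr 1); apply: gen_sub_add; [|apply: gsN]. Qed.

Let gsq1 n : gen_sub n (q - 1).
Proof. by apply: gen_sub_add; [|apply: gsN]. Qed.

Hint Resolve gs0 gs1 gsq gsqi gsq1 : core.

Let gsX n x j : gen_sub n x -> gen_sub n (x ^+ j).
Proof.
by move=> Hx; elim: j => [|j IH]; rewrite ?expr0 // exprS; apply: gen_sub_mul.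
Qed.

Let gsW n x : gen_sub n x -> gen_sub n.+1 x.
Proof.
elim=> {x} [c|i|x y _ ? _ ?|x y _ ? _ ?].
- exact: gen_sub_cst.
- by move=> /ltnW; rewrite -ltnS; apply: gen_sub_T.
- exact: gen_sub_add.
- exact: gen_sub_mul.
Qed.

Let gs0_central c x : gen_sub 0 c -> c * x = x * c.
Proof.
elim=> {c} [c|i|c d _ Hc _ Hd|c d _ Hc _ Hd] //; first exact: C_central.
- by rewrite mulrDl mulrDr Hc Hd.
- by rewrite -mulrA Hd mulrA Hc mulrA.
Qed.

Let q_central x : q * x = x * q. Proof. exact: C_central. Qed.

Let gs_commT n x : gen_sub n x -> x * T n.+1 = T n.+1 * x.
Proof.
elim=> {x} [c|i|x y _ Hx _ Hy|x y _ Hx _ Hy].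
- exact: C_central.
- by move=> i_n; apply: T_comm.
- by rewrite mulrDl mulrDr Hx Hy.
- by rewrite -mulrA Hy mulrA Hx mulrA.
Qed.

Let J_gs n : gen_sub n.+1 (J n).
Proof.
elim: n => [|n IH]; first by rewrite J0; apply: gen_sub_T.
rewrite JS.
by apply: gen_sub_mul; [apply: gen_sub_mul|]; try exact: gen_sub_T; apply: gsW.
Qed.

(** Below the top index this follows by induction, [T i] commuting with the outer factors of [J n].
    At the top index, [T_0] against [T_1 T_0 T_1] is the four-term relation; otherwise two outer
    layers of [J] are peeled off and the braid relation is applied on each side of the core, which
    commutes with the outermost factor. *)
Lemma jucys_murphy_commT n i : (i < n)%N -> T i * J n = J n * T i.
Proof.
elim: n i => // n IH i; rewrite ltnS leq_eqVlt => /orP[/eqP->|i_n]; rewrite JS;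
  last first.
  have Tin : T i * T n.+1 = T n.+1 * T i by apply: T_comm; rewrite ltnS.
  by rewrite !mulrA Tin -(mulrA _ (T i)) IH // -!mulrA Tin.
case: n {IH} => [|n]; first by rewrite J0 !mulrA T_quad.
rewrite JS.
have TJ : J n * T n.+2 = T n.+2 * J n by apply: gs_commT.
rewrite !mulrA T_braid -(mulrA _ (T n.+2) (J n)) -TJ -!mulrA.
by congr (_ * (_ * (_ * _))); rewrite !mulrA -T_braid.
Qed.

Let J_comm n a : gen_sub n a -> a * J n = J n * a.
Proof.
elim=> {a} [c|i|x y _ Hx _ Hy|x y _ Hx _ Hy].
- exact: C_central.
- exact: jucys_murphy_commT.
- by rewrite mulrDl mulrDr Hx Hy.
- by rewrite -mulrA Hy mulrA Hx mulrA.
Qed.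

Let JX_comm n j a : gen_sub n a -> a * J n ^+ j = J n ^+ j * a.
Proof. by move=> Ha; apply: (commrX j (x := a)); apply: J_comm. Qed.

(** The quadratic relation applied to the last factor of [J n.+1]. *)
Let J_T n : J n.+1 * T n.+1 = (q - 1) * J n.+1 + q * T n.+1 * J n.
Proof.
rewrite JS -mulrA T_sq mulrDr; congr (_ + _); last by rewrite -q_central mulrA.
by rewrite mulrA -(gs0_central _ (gsq1 0)) !mulrA.
Qed.

(* The decomposition H_{n+1} = H_n T_n H_n + sum_j J_n^j H_n, as in the Mackey
   formula: J_n = T_n ... T_1 T_0 T_1 ... T_n, unlike L_n, commutes with H_n. *)
Inductive jm_form (n : nat) : A -> Prop :=
| jm_form_pow j a : gen_sub n a -> jm_form n (J n ^+ j * a)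
| jm_form_T a b : (0 < n)%N -> gen_sub n a -> gen_sub n b ->
    jm_form n (a * T n * b).

Local Notation MJ n := (sums_of (jm_form n)).

Let MJ_base n a : gen_sub n a -> MJ n a.
Proof. by move=> Ha; rewrite -[a]mul1r -(expr0 (J n)); apply/sums_gen/jm_form_pow. Qed.

Let MJ_T n a b : (0 < n)%N -> gen_sub n a -> gen_sub n b -> MJ n (a * T n * b).
Proof. by move=> *; apply/sums_gen/jm_form_T. Qed.

Let MJ_mull n a x : gen_sub n a -> MJ n x -> MJ n (a * x).
Proof.
move=> Ha; apply: sums_morph x => [x y|x]; first by rewrite mulrDr.
case=> [j b Hb|b c n0 Hb Hc].
  rewrite mulrA JX_comm // -mulrA.
  by apply/sums_gen/jm_form_pow/gen_sub_mul.
by rewrite !mulrA; apply: MJ_T => //; apply: gen_sub_mul.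
Qed.

Let MJ_mulr n a x : gen_sub n a -> MJ n x -> MJ n (x * a).
Proof.
move=> Ha; apply: (sums_morph (f := fun x => x * a)) x => [x y|x];
  first by rewrite mulrDl.
case=> [j b Hb|b c n0 Hb Hc]; rewrite -mulrA.
  by apply/sums_gen/jm_form_pow/gen_sub_mul.
by apply: MJ_T => //; apply: gen_sub_mul.
Qed.

Let MJ_J n x : MJ n x -> MJ n (J n * x).
Proof.
apply: sums_morph x => [x y|x]; first by rewrite mulrDr.
case=> [j b Hb|a b].
  by rewrite mulrA -exprS; apply/sums_gen/jm_form_pow.
case: n => // n _ Ha Hb.
rewrite !mulrA -J_comm // -(mulrA a) J_T mulrDr mulrDl; apply: sums_add.
  rewrite -!mulrA; apply: MJ_mull => //; apply: MJ_mull => //.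
  by rewrite -[J n.+1]expr1; apply/sums_gen/jm_form_pow.
rewrite !mulrA -(mulrA _ (J n)); apply: MJ_T => //; apply: gen_sub_mul => //.
Qed.

Let MJ_JX n j x : MJ n x -> MJ n (J n ^+ j * x).
Proof.
by move=> Hx; elim: j => [|j IH]; rewrite ?mul1r // exprS -mulrA; apply: MJ_J.
Qed.

(** Induction on [j]: [J_T], solved for [T n.+1 * J n], moves one factor [J n] to the far left,
    where it becomes [J n.+1] and is absorbed by [MJ_J]. The case [j = 0] is the quadratic
    relation. *)
Let MJ_TJT n j : MJ n.+1 (T n.+1 * J n ^+ j * T n.+1).
Proof.
elim: j => [|j IH].
  rewrite expr0 mulr1 T_sq; apply: sums_add; last exact: MJ_base.
  by rewrite -[_ * _]mulr1; apply: MJ_T.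
have -> : T n.+1 * J n ^+ j.+1 * T n.+1 = qi * (J n.+1 * (T n.+1 * J n ^+ j * T n.+1))
    + - qi * (q - 1) * (J n.+1 * (J n ^+ j * T n.+1 * 1)).
  have -> : T n.+1 * J n ^+ j.+1 = qi * (J n.+1 * T n.+1 - (q - 1) * J n.+1) * J n ^+ j.
    by rewrite J_T addrC addKr exprS !mulrA qi_q mul1r.
  by move: (q - 1) => p; rewrite mulr1 mulrBr !mulrBl !mulNr !mulrA.
apply: sums_add; first by apply/MJ_mull => //; apply: MJ_J.
apply: MJ_mull; first by apply: gen_sub_mul => //; apply: gsN.
by apply: MJ_J; apply: MJ_T => //; apply: gsX.
Qed.

Let T_braid' n : (0 < n)%N -> T n * T n.+1 * T n = T n.+1 * T n * T n.+1.
Proof. by case: n. Qed.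

Lemma gen_sub_jm n x : gen_sub n.+1 x -> MJ n x.
Proof.
elim: n x => [|n IHn] x Hx.
  (* The left factor 1 is generalized to any [h] in the span, so that the induction on [x] only has
     to multiply [h] on the right by generators. *)
  rewrite -[x]mul1r; move: (MJ_base (gs1 0)); move: {1 2}(1 : A).
  elim: Hx => {x} [c Hc|i i_1|x y _ Hx _ Hy|x y _ Hx _ Hy] h Hh.
  - by apply: MJ_mulr => //; apply: gen_sub_cst.
  - case: i i_1 => // _; apply: (sums_morph (f := fun x => x * _)) Hh => [y z|y];
    first by rewrite mulrDl.
    case=> [j a Ha|//]; rewrite -mulrA (gs0_central _ Ha) mulrA.
    by rewrite -J0 -exprSr; apply/sums_gen/jm_form_pow.
  - by rewrite mulrDr; apply: sums_add; [apply: Hx|apply: Hy].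
  - by rewrite mulrA; apply: Hy; apply: Hx.
(* Only right multiplication by the new generator is in doubt. It creates [T n.+1 * b * T n.+1] with
   [b] in the smaller algebra, and [b] is expanded by the induction hypothesis. *)
have MT h : MJ n.+1 h -> MJ n.+1 (h * T n.+1).
  apply: (sums_morph (f := fun x => x * _)) => [y z|y]; first by rewrite mulrDl.
  case=> [j a Ha|a b _ Ha /IHn Hb].
    by rewrite -mulrA; apply: MJ_JX; rewrite -[_ * _]mulr1; apply: MJ_T.
  rewrite -!mulrA; apply: MJ_mull => //.
  apply: (sums_morph (f := fun x => T n.+1 * (x * T n.+1))) Hb => [y' z'|z].
    by rewrite mulrDl mulrDr.
  case=> [j c Hc|].
    rewrite -mulrA gs_commT // !mulrA; apply: MJ_mulr; first exact: gsW.
    exact: MJ_TJT.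
  (* Here [c] and [d] commute with [T n.+1], and the braid relation leaves a single [T n.+1] between
     two [T n]. *)
  move=> c d n_gt0 Hc Hd.
  rewrite -mulrA gs_commT // !mulrA -gs_commT //.
  rewrite -(mulrA c) -(mulrA c) -T_braid' // !mulrA -(mulrA _ _ d).
  by apply: MJ_T => //; apply: gen_sub_mul; try (exact: gsW); apply: gen_sub_T.
rewrite -[x]mul1r; move: (MJ_base (gs1 n.+1)); move: {1 2}(1 : A).
elim: Hx => {x} [c Hc|i i_n|x y _ Hx _ Hy|x y _ Hx _ Hy] h Hh.
- by apply: MJ_mulr => //; apply: gen_sub_cst.
- move: i_n; rewrite ltnS leq_eqVlt => /orP[/eqP->|i_n]; first exact: MT.
  by apply: MJ_mulr => //; apply: gen_sub_T.
- by rewrite mulrDr; apply: sums_add; [apply: Hx|apply: Hy].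
- by rewrite mulrA; apply: Hy; apply: Hx.
Qed.

(** An intermediate form free of powers of [J n]: it links the decomposition by [J] to the one by
    [L], which the Markov rules require. *)
Inductive sandwich_form (n : nat) : A -> Prop :=
| sandwich0 a : gen_sub n a -> sandwich_form n a
| sandwich1 a b : gen_sub n a -> gen_sub n b -> sandwich_form n (a * T n * b)
| sandwich2 a b c : gen_sub n a -> gen_sub n b -> gen_sub n c ->
    sandwich_form n (a * T n * b * T n * c).

Local Notation MT n := (sums_of (sandwich_form n)).

Let MT1 n a b : gen_sub n a -> gen_sub n b -> MT n (a * T n * b).
Proof. by move=> *; apply/sums_gen/sandwich1. Qed.

Let MT2 n a b c : gen_sub n a -> gen_sub n b -> gen_sub n c ->
  MT n (a * T n * b * T n * c).
Proof. by move=> *; apply/sums_gen/sandwich2. Qed.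

Let MT_mull n a x : gen_sub n a -> MT n x -> MT n (a * x).
Proof.
move=> Ha; apply: sums_morph x => [x y|x]; first by rewrite mulrDr.
case=> [b Hb|b c Hb Hc|b c d Hb Hc Hd]; rewrite ?mulrA.
- exact/sums_gen/sandwich0/gen_sub_mul.
- by apply: MT1 => //; apply: gen_sub_mul.
- by apply: MT2 => //; apply: gen_sub_mul.
Qed.

Let MT_mulr n a x : gen_sub n a -> MT n x -> MT n (x * a).
Proof.
move=> Ha; apply: (sums_morph (f := fun x => x * a)) x => [x y|x];
  first by rewrite mulrDl.
case=> [b Hb|b c Hb Hc|b c d Hb Hc Hd]; rewrite -1?(mulrA _ _ a).
- exact/sums_gen/sandwich0/gen_sub_mul.
- by apply: MT1 => //; apply: gen_sub_mul.
- by apply: MT2 => //; apply: gen_sub_mul.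
Qed.

(** [J n.+1] commutes with the left coefficient; when it meets [T n.+1], [J_T] replaces it by [J n],
    an element of the smaller algebra, up to a term with one [T n.+1] fewer. So never more than two
    factors [T n.+1] remain. *)
Let MT_J n x : MT n.+1 x -> MT n.+1 (J n.+1 * x).
Proof.
have J2 : J n.+1 = 1 * T n.+1 * J n * T n.+1 * 1 by rewrite JS mulr1 mul1r.
have MJ : MT n.+1 (J n.+1) by rewrite J2; apply: MT2.
have MJT : MT n.+1 (J n.+1 * T n.+1).
  rewrite J_T; apply: sums_add; first exact: MT_mull.
  by apply: MT1.
apply: sums_morph x => [x y|x]; first by rewrite mulrDr.
case=> [b Hb|b c Hb Hc|b c d Hb Hc Hd]; rewrite ?mulrA -J_comm //.
- exact: MT_mull.
- by rewrite -(mulrA b); apply: MT_mulr => //; apply: MT_mull.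
apply: MT_mulr => //; rewrite -(mulrA b) -!mulrA; apply: MT_mull => //.
rewrite !mulrA J_T; move: (q - 1) (gsq1 n.+1) => p Hp; rewrite !mulrDl.
apply: sums_add; last first.
  have -> : q * T n.+1 * J n * c * T n.+1 = q * (1 * T n.+1 * (J n * c) * T n.+1 * 1).
    by rewrite mul1r mulr1 !mulrA.
  by apply: MT_mull => //; apply: MT2 => //; apply: gen_sub_mul.
rewrite -!mulrA; apply: MT_mull => //.
by rewrite mulrA -J_comm // -mulrA; apply: MT_mull.
Qed.

Lemma gen_sub_sandwich n x : gen_sub n.+2 x -> MT n.+1 x.
Proof.
move/gen_sub_jm; rewrite -{2}[x]/(id x); apply: sums_morph => // y [j a Ha|a b _ Ha Hb].
  apply: MT_mulr => //; elim: j => [|j IH]; last by rewrite exprS; apply: MT_J.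
  exact/sums_gen/sandwich0.
exact: MT1.
Qed.

(** The elements to which the rules of a Markov trace apply. Coefficients stand on both sides
    because [L n] need not commute with them; the exponent [j = 0] accounts for the smaller algebra
    itself. *)
Inductive markov_form (n : nat) : A -> Prop :=
| markov_form_L j a b : (j < e)%N -> gen_sub n a -> gen_sub n b ->
    markov_form n (a * L n ^+ j * b)
| markov_form_T a b : (0 < n)%N -> gen_sub n a -> gen_sub n b ->
    markov_form n (a * T n * b).

Local Notation ML n := (sums_of (markov_form n)).

Let ML_base n a : gen_sub n a -> ML n a.
Proof.
by move=> Ha; rewrite -[a]mulr1 -[a]mulr1 -{1}(expr0 (L n));
  apply/sums_gen/markov_form_L.
Qed.

Let ML_T n a b : gen_sub n.+1 a -> gen_sub n.+1 b -> ML n.+1 (a * T n.+1 * b).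
Proof. by move=> *; apply/sums_gen/markov_form_T. Qed.

Let ML_mull n a x : gen_sub n a -> ML n x -> ML n (a * x).
Proof.
move=> Ha; apply: sums_morph x => [x y|x]; first by rewrite mulrDr.
case=> [j b c j_e Hb Hc|b c n0 Hb Hc]; rewrite !mulrA; apply: sums_gen.
  by apply: markov_form_L => //; apply: gen_sub_mul.
by apply: markov_form_T => //; apply: gen_sub_mul.
Qed.

Let ML_mulr n a x : gen_sub n a -> ML n x -> ML n (x * a).
Proof.
move=> Ha; apply: (sums_morph (f := fun x => x * a)) x => [x y|x];
  first by rewrite mulrDl.
case=> [j b c j_e Hb Hc|b c n0 Hb Hc]; rewrite -(mulrA _ c); apply: sums_gen.
  by apply: markov_form_L => //; apply: gen_sub_mul.
by apply: markov_form_T => //; apply: gen_sub_mul.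
Qed.

Let T_Ti_q i : T i.+1 = (q - 1) + q * Ti i.+1.
Proof.
by rewrite -[LHS]mulr1 -(T_Ti i) mulrA T_sq mulrDl -mulrA T_Ti mulr1.
Qed.

Let Ti_gs i : gen_sub i.+2 (Ti i.+1).
Proof.
have -> : Ti i.+1 = qi * (T i.+1 - (q - 1))
  by rewrite T_Ti_q addrC addKr mulrA qi_q mul1r.
by apply: gen_sub_mul => //; apply: gen_sub_add; [apply: gen_sub_T|apply: gsN].
Qed.

Let L_gs n : gen_sub n.+1 (L n).
Proof.
elim: n => [|n IH]; first by rewrite L0; apply: gen_sub_T.
rewrite LS; apply: gen_sub_mul => //; apply: gen_sub_mul; last exact: gsW.
exact: gen_sub_T.
Qed.

Let LSX n j : L n.+1 ^+ j = T n.+1 * L n ^+ j * Ti n.+1.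
Proof.
elim: j => [|j IH]; first by rewrite !expr0 mulr1 T_Ti.
rewrite exprS IH LS -!mulrA (mulrA (Ti _)) Ti_T mul1r !mulrA.
by rewrite -(mulrA _ (L n)) -exprS.
Qed.

(** For [n = 0] the cyclotomic relation lowers the powers of [T_0]. In the step only
    [T n.+1 * b * T n.+1] needs work: [b] is put in Markov form by induction, its coefficients are
    moved outside, and the core is a power of [L n] or a single [T n], the latter being settled by
    the braid relation. *)
Lemma gen_sub_markov n x : gen_sub n.+1 x -> ML n x.
Proof.
elim: n x => [|n IHn] x.
  have MT0 h : ML 0 h -> ML 0 (h * T 0%N).
    apply: (sums_morph (f := fun x => x * _)) => [y z|y]; first by rewrite mulrDl.
    case=> [j a b j_e Ha Hb|//]; rewrite -mulrA (gs0_central _ Hb) mulrA.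
    apply: ML_mulr => //; rewrite -mulrA; apply: ML_mull => //; rewrite L0 -exprSr.
    have [j1_e|] := ltnP j.+1 e.
      by rewrite -L0 -[_ ^+ _]mul1r -[_ * _]mulr1; apply/sums_gen/markov_form_L.
    rewrite leq_eqVlt => /orP[/eqP <-|]; last by rewrite ltnS leqNgt j_e.
    apply: (sums_morph (f := id)) T0_pow => // z [i c i_e Hc].
    by rewrite -L0 -[X in ML _ X]mulr1; apply/sums_gen/markov_form_L.
  move=> Hx; rewrite -[x]mul1r; move: (ML_base (gs1 0)); move: {1 2}(1 : A).
  elim: Hx => {x} [c Hc|i i_1|x y _ Hx _ Hy|x y _ Hx _ Hy] h Hh.
  - by apply: ML_mulr => //; apply: gen_sub_cst.
  - by case: i i_1 => // _; apply: MT0.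
  - by rewrite mulrDr; apply: sums_add; [apply: Hx|apply: Hy].
  - by rewrite mulrA; apply: Hy; apply: Hx.
move/gen_sub_sandwich; rewrite -{2}[x]/(id x); apply: sums_morph => //.
move=> y [a Ha|a b Ha Hb|a b c Ha /IHn Hb Hc]; [exact: ML_base|exact: ML_T|].
apply: ML_mulr => //; rewrite -!mulrA; apply: ML_mull => //.
apply: (sums_morph (f := fun x => T n.+1 * (x * T n.+1))) Hb => [y' z'|z].
  by rewrite mulrDl mulrDr.
case=> [j d f j_e Hd Hf|d f n_gt0 Hd Hf].
  rewrite -mulrA gs_commT // !mulrA -gs_commT //; apply: ML_mulr; first exact: gsW.
  rewrite -!mulrA; apply: ML_mull; first exact: gsW.
  (* Only the right-hand [T n.+1] is written as [q - 1 + q * Ti n.+1], so that the second term is a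
     conjugate, namely [q] times a power of [L n.+1]. *)
  rewrite {2}T_Ti_q; move: (q - 1) (gsq1 n.+1) => p Hp; rewrite !mulrDr.
  apply: sums_add.
    by rewrite -[T _]mul1r; apply: ML_T => //; apply: gen_sub_mul => //; apply/gsX/L_gs.
  have -> : T n.+1 * (L n ^+ j * (q * Ti n.+1)) = q * (1 * L n.+1 ^+ j * 1).
    by rewrite mul1r mulr1 LSX !mulrA -q_central !mulrA.
  by apply: ML_mull => //; apply/sums_gen/markov_form_L.
rewrite -mulrA gs_commT // !mulrA -gs_commT //.
rewrite -(mulrA d) -(mulrA d) -T_braid' // !mulrA -(mulrA _ _ f).
by apply: ML_T => //; apply: gen_sub_mul; try (exact: gsW); apply: gen_sub_T.
Qed.

End CyclotomicSpanning.

(** * Homomorphisms of presented algebras sending generators to arbitrary terms, in particular to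
    scalars *)

Fixpoint aterm_subst (F I J : Type) (s : I -> aterm F J) (a : aterm F I) : aterm F J :=
  match a with
  | AGen i => s i
  | ACst c => ACst c
  | AAdd a b => AAdd (aterm_subst s a) (aterm_subst s b)
  | AMul a b => AMul (aterm_subst s a) (aterm_subst s b)
  end.

Section PresentedAlgebraSubst.
Local Open Scope quotient_scope.
Variables (F : comPzRingType) (I J : Type) (s : I -> aterm F J).
Variables (R : aterm F I -> aterm F I -> Prop) (S : aterm F J -> aterm F J -> Prop).

Definition palg_subst (x : palg R) : palg S := \pi_(palg S) (aterm_subst s (repr x)).

Hypothesis sR : forall a b, R a b -> aterm_eq S (aterm_subst s a) (aterm_subst s b).

Lemma aterm_subst_eq a b :
  aterm_eq R a b -> aterm_eq S (aterm_subst s a) (aterm_subst s b).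
Proof.
elim=> /=.
- by move=> *; apply: aeq_refl.
- by move=> *; apply: aeq_sym.
- by move=> {}b {}a c _ ab _; apply: aeq_trans.
- by move=> *; apply: aeq_add.
- by move=> *; apply: aeq_mul.
- by move=> *; apply: aeq_addA.
- by move=> *; apply: aeq_addC.
- by move=> *; apply: aeq_add0.
- by move=> *; apply: aeq_mulA.
- by move=> *; apply: aeq_mul1.
- by move=> *; apply: aeq_mul0.
- by move=> *; apply: aeq_mulDl.
- by move=> *; apply: aeq_mulDr.
- by move=> *; apply: aeq_cstD.
- by move=> *; apply: aeq_cstM.
- by move=> *; apply: aeq_cstC.
- exact: sR.
Qed.

Lemma palg_subst_pi a : palg_subst (\pi a) = \pi_(palg S) (aterm_subst s a).
Proof. by apply/palgP; apply: aterm_subst_eq; apply: aterm_eq_repr. Qed.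

Lemma palg_substD : {morph palg_subst : x y / x + y}.
Proof. by elim/quotW=> a; elim/quotW=> b; rewrite palgD !palg_subst_pi palgD. Qed.

Lemma palg_substM : {morph palg_subst : x y / x * y}.
Proof. by elim/quotW=> a; elim/quotW=> b; rewrite palgM !palg_subst_pi palgM. Qed.

Lemma palg_substZ c : {morph palg_subst : x / c *: x}.
Proof. by elim/quotW=> a; rewrite palgZ !palg_subst_pi palgZ. Qed.

Lemma palg_subst1 : palg_subst 1 = 1.
Proof. exact: palg_subst_pi. Qed.

Lemma palg_subst_gen i : palg_subst (palg_gen R i) = \pi_(palg S) (s i).
Proof. exact: palg_subst_pi. Qed.

End PresentedAlgebraSubst.

Lemma morph_ring_inv (A B : pzRingType) (f : A -> B) (x : A) :
  {morph f : x y / x * y} -> f 1 = 1 -> (exists2 y, x * y = 1 & y * x = 1) ->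
  f (ring_inv x) = ring_inv (f x).
Proof.
move=> fM f1 [y xy yx]; rewrite (ring_invE xy yx).
by apply/esym/ring_invE; rewrite -fM ?xy ?yx f1.
Qed.

(** * The homomorphism [f_p] replacing [T_0] by the scalar [u_p] *)

Section ScalarSpecialization.
Local Open Scope quotient_scope.
Variables (F : fieldType) (e e' : nat) (q : F) (u : 'I_e -> F) (u' : 'I_e' -> F).
Variable p : 'I_e.

Definition T0_scalar_subst (i : nat) : aterm F nat :=
  if i is 0 then ACst (u p) else AGen i.

Definition T0_scalar (x : AK q u) : AK q u' :=
  palg_subst T0_scalar_subst (AK_rel q u' (@id nat)) x.

Local Notation B := (palg (AK_rel q u' (@id nat))).

(** The cyclotomic product contains the factor [T_0 - u_p], which becomes 0; the braid relations
    involving [T_0] hold because its image is central, and the others are those of the target. *)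
Let T0_scalar_rel a b : AK_rel q u (@id nat) a b ->
  aterm_eq (AK_rel q u' (@id nat)) (aterm_subst T0_scalar_subst a)
    (aterm_subst T0_scalar_subst b).
Proof.
have word_pi (w : seq nat) :
    \pi_B (aterm_subst T0_scalar_subst (aterm_word F w)) =
    \prod_(i <- w) \pi_B (T0_scalar_subst i).
  by elim: w => [|i w IH]; rewrite (big_nil, big_cons) //= -palgM IH.
have central (c : F) (x : B) : (c *: (1 : B)) * x = x * (c *: (1 : B)).
  by rewrite -palg_scalerAl -palg_scalerAr mulr1 mul1r.
case=> [i /= ->|i i0|w w'].
- rewrite (big_morph (aterm_subst T0_scalar_subst)
    (id1 := ACst 1) (op1 := @AMul F nat)) //=.
  apply/palgP; rewrite (big_morph (\pi_B) (id1 := 1) (op1 := *%R)) //; last first.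
    by move=> x y; rewrite palgM.
  case/splitPr: (mem_index_enum p) => r1 r2; rewrite big_cat big_cons /=.
  by rewrite -palgD !palg_cst -scalerDl subrr scale0r mul0r mulr0.
- apply: aeq_rel; case: i i0 => //= i _.
  exact: (@AK_quadratic _ _ _ _ _ (@id nat)).
move=> ww'; apply/palgP; rewrite !word_pi; case: ww' => i j /=.
- move=> -> ->; rewrite !big_cons !big_nil /= palg_cst !mulr1 !mulrA.
  move: (\pi_B (AGen 1)) => x.
  by rewrite -!(central _ x) -(central _ (_ * x)) -(central _ (_ * x * x)) !mulrA.
- case: i j => [|i] [|j] //= ij;
  rewrite !big_cons !big_nil /= !mulr1 ?palg_cst ?central //.
  have := AK_braidE q u' (@brel_comm _ (@id nat) i.+1 j.+1 ij).
  by rewrite !big_cons !big_nil /= !mulr1; apply.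
- case: i j => [|i] [|j] //= i0 ij.
  have := AK_braidE q u' (@brel_triple _ (@id nat) i.+1 j.+1 i0 ij).
  by rewrite !big_cons !big_nil /= !mulr1; apply.
Qed.

Lemma T0_scalarD : {morph T0_scalar : x y / x + y}.
Proof. exact: palg_substD T0_scalar_rel. Qed.

Lemma T0_scalarM : {morph T0_scalar : x y / x * y}.
Proof. exact: palg_substM T0_scalar_rel. Qed.

Lemma T0_scalarZ c : {morph T0_scalar : x / c *: x}.
Proof. exact: palg_substZ T0_scalar_rel c. Qed.

Lemma T0_scalar1 : T0_scalar 1 = 1.
Proof. exact: palg_subst1 T0_scalar_rel. Qed.

Lemma T0_scalar_T0 : T0_scalar (AKT q u 0) = u p *: (1 : AK q u').
Proof. by rewrite -palg_cst; apply: palg_subst_gen T0_scalar_rel 0. Qed.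

Lemma T0_scalar_T i : T0_scalar (AKT q u i.+1) = AKT q u' i.+1.
Proof. exact: palg_subst_gen T0_scalar_rel i.+1. Qed.

End ScalarSpecialization.

Lemma size_index_enum_ord n : size (index_enum 'I_n) = n.
Proof. by rewrite -sum1_size (eq_bigl (mem predT)) // sum1_card card_ord. Qed.

(** * The Ariki-Koike algebra over a subring [O] of the field, and integrality of the rescaled
    trace *)

Section ArikiKoikeLattice.
Variables (F : fieldType) (O : F -> Prop) (q : F).
Hypotheses (O1 : O 1) (ON1 : O (-1)) (Oq : O q) (OqV : O q^-1).
Hypothesis OD : forall a b, O a -> O b -> O (a + b).
Hypothesis OM : forall a b, O a -> O b -> O (a * b).
Hypothesis q_neq0 : q != 0.

Let O0 : O 0. Proof. by rewrite -(subrr 1); apply: OD. Qed.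

Section OneAlgebra.
Variables (e : nat) (u : 'I_e -> F).
Hypothesis e_gt0 : (0 < e)%N.
Hypothesis u_neq0 : forall p, u p != 0.
Hypothesis Ou : forall p, O (u p).
Local Notation H := (AK q u).
Local Notation T := (AKT q u).

(* O plays the role of the ring of functions regular at the evaluation point. *)
Definition AK_scalar (x : H) : Prop := exists2 c, O c & x = c *: (1 : H).

Local Notation sub := (gen_sub AK_scalar T).

Lemma AK_scalerAl c (x y : H) : c *: (x * y) = c *: x * y.
Proof. exact: palg_scalerAl. Qed.

Lemma AK_scalerAr c (x y : H) : c *: (x * y) = x * (c *: y).
Proof. exact: palg_scalerAr. Qed.

Lemma AKT_ring_inv i : T i * ring_inv (T i) = 1 /\ ring_inv (T i) * T i = 1.
Proof.
have [y Ty yT] := @AK_gen_inv _ _ q u nat (@id nat) q_neq0 u_neq0 i.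
by rewrite (ring_invE Ty yT).
Qed.

Lemma AK_scalar_gen_sub0 x : sub 0 x -> AK_scalar x.
Proof.
elim=> {x} // [x y _ [c Oc ->] _ [d Od ->]|x y _ [c Oc ->] _ [d Od ->]].
  by exists (c + d); [apply: OD|rewrite scalerDl].
by exists (c * d); [apply: OM|rewrite -AK_scalerAl mul1r scalerA].
Qed.

Lemma AK_scalar_central x y : AK_scalar x -> x * y = y * x.
Proof. by case=> c _ ->; rewrite -AK_scalerAl -AK_scalerAr mul1r mulr1. Qed.

Let cst_sub n c : O c -> sub n (c *: (1 : H)).
Proof. by move=> Oc; apply: gen_sub_cst; exists c. Qed.

Let scale_sub n c x : O c -> sub n x -> sub n (c *: x).
Proof.
by move=> Oc Hx; rewrite -[x]mul1r AK_scalerAl; apply: gen_sub_mul => //;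
  apply: cst_sub.
Qed.

(** Multiplying out the factors [T_0 - u_p] one at a time, the product over a list [r] differs from
    [T_0 ^ (size r)] by lower powers over [O]; over all [p] the product is 0. *)
Lemma AKT0_low_power : sums_of (low_power AK_scalar T e) (T 0%N ^+ e).
Proof.
have mulS k c x : O c -> sums_of (low_power AK_scalar T k) x ->
    sums_of (low_power AK_scalar T k) (c *: x).
  move=> Oc; apply: sums_morph x => [x y|x [j a j_k Ha]]; first by rewrite scalerDr.
  by rewrite AK_scalerAl; apply/sums_gen/low_power_mon/scale_sub.
have weaken k x : sums_of (low_power AK_scalar T k) x ->
    sums_of (low_power AK_scalar T k.+1) x.
  apply: (sums_morph (f := id)) => // y [j a j_k Ha].
  by apply/sums_gen/low_power_mon => //; apply: leqW.
have mulT k x : sums_of (low_power AK_scalar T k) x ->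
    sums_of (low_power AK_scalar T k.+1) (T 0%N * x).
  apply: sums_morph x => [x y|x [j a j_k Ha]]; first by rewrite mulrDr.
  rewrite mulrA -(AK_scalar_central _ (AK_scalar_gen_sub0 Ha)) -mulrA -exprS.
  exact/sums_gen/low_power_mon.
have P (r : seq 'I_e) : sums_of (low_power AK_scalar T (size r))
    (T 0%N ^+ size r - \prod_(p <- r) (T 0%N - u p *: (1 : H))).
  elim: r => [|p r IH]; first by rewrite big_nil subrr; apply: sums_0.
  rewrite big_cons /= exprS.
  set P := \prod_(_ <- _) _ in IH *.
  have -> : T 0%N * T 0%N ^+ size r - (T 0%N - u p *: (1 : H)) * P =
      T 0%N * (T 0%N ^+ size r - P) + (u p *: T 0%N ^+ size r
        + (-1) *: (u p *: (T 0%N ^+ size r - P))).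
    rewrite mulrBl mulrBr opprB -AK_scalerAl mul1r scaleN1r scalerBr opprB.
    by rewrite [X in _ = _ + X]addrC subrK -addrA (addrC (- _)).
  apply: sums_add; first exact: mulT.
  apply: sums_add; last by apply/mulS/mulS/weaken.
  rewrite -[X in _ *: X]mul1r AK_scalerAl; apply/sums_gen/low_power_mon => //.
  exact: cst_sub.
have := P (index_enum 'I_e).
rewrite size_index_enum_ord.
by rewrite (@AK_cyclotomicE _ _ q u nat (@id nat)) // subr0.
Qed.

Lemma AK_gen_sub_markov n x : sub n.+1 x ->
  sums_of (markov_form AK_scalar T (AKL q u) e n) x.
Proof.
pose J := fix J n : H := if n is k.+1 then T k.+1 * J k * T k.+1 else T 0%N.
apply: (@gen_sub_markov H AK_scalar T (fun i => ring_inv (T i)) (AKL q u) J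
  (q *: (1 : H)) (q^-1 *: (1 : H))) => //.
- exact: AK_scalar_central.
- by exists 1; rewrite ?scale1r.
- by exists (-1); rewrite ?scaleN1r.
- by exists q.
- by exists q^-1.
- by rewrite -AK_scalerAl mul1r scalerA mulVf // scale1r.
- move=> i; have := @AK_quadraticE _ _ q u nat (@id nat) i.+1 isT.
  rewrite -/(AKT q u i.+1) mulrDr mulr1 mulrBl -AK_scalerAl mul1r => E.
  apply/eqP; rewrite -subr_eq0; apply/eqP; rewrite -[RHS]E mulrBl -AK_scalerAl !mul1r.
  by rewrite opprD opprB (addrC (T i.+1) (- _)) !addrA.
- by move=> i; case: (AKT_ring_inv i.+1).
- by move=> i; case: (AKT_ring_inv i.+1).
- move=> i j ij; have := AK_braidE q u (@brel_comm _ (@id nat) i j ij).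
  by rewrite !big_cons !big_nil !mulr1.
- move=> i; have := AK_braidE q u (@brel_triple _ (@id nat) i.+1 i.+2 isT erefl).
  by rewrite !big_cons !big_nil !mulr1 !mulrA.
- have := AK_braidE q u (@brel_quad _ (@id nat) 0 1 erefl erefl).
  by rewrite !big_cons !big_nil !mulr1 !mulrA.
- exact: AKT0_low_power.
Qed.

(** The Markov rules are stated for images of [AKn], the spanning results for [gen_sub]; this passes
    from the latter to the former. *)
Lemma gen_sub_AKn_incl n x : sub n x -> exists h : AKn q u n, AKn_incl h = x.
Proof.
elim=> {x} [_ [c _ ->]|i i_n|x y _ [h <-] _ [h' <-]|x y _ [h <-] _ [h' <-]].
- by exists (c *: (1 : AKn q u n)); rewrite AKn_inclZ AKn_incl1.
- by exists (AKnT q u (Ordinal i_n)); rewrite AKn_incl_gen.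
- by exists (h + h'); rewrite AKn_inclD.
- by exists (h * h'); rewrite AKn_inclM.
Qed.

(** For [i > 0] the quadratic relation gives the inverse as [q^-1 (T_i + 1 - q)]. For [i = 0] the
    cyclotomic relation reads [T_0 Q + d = 0], where [d] is the product of the [- u_p], a unit of
    [O], so the inverse is [- d^-1 Q]. *)
Lemma gen_sub_ring_inv n i : (forall p, O (u p)^-1) -> (i < n)%N ->
  sub n (ring_inv (T i)).
Proof.
move=> OuV i_n; have [Ty yT] := AKT_ring_inv i; move: (ring_inv _) Ty yT => y Ty yT.
case: i i_n Ty yT => [|i] i_n Ty yT; last first.
  have := @AK_quadraticE _ _ q u nat (@id nat) i.+1 isT.
  move=> /(congr1 ( *%R y)); rewrite mulr0 mulrA mulrBr -AK_scalerAr mulr1 yT.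
  rewrite mulrDr mulr1 mulrBl mul1r -AK_scalerAl yT => /eqP.
  rewrite addrA subr_eq0 => /eqP E; rewrite -[y]scale1r -(mulVf q_neq0) -scalerA -E.
  apply: scale_sub => //; apply: gen_sub_add; last by rewrite -(scale1r (1 : H));
    apply: cst_sub.
  apply: gen_sub_add; first exact: gen_sub_T.
  by rewrite -scaleNr; apply: cst_sub; rewrite -mulN1r; apply: OM.
have P (r : seq 'I_e) : exists Q, exists d, [/\ sub n Q, O d /\ O d^-1, d != 0 &
    \prod_(p <- r) (T 0%N - u p *: (1 : H)) = T 0%N * Q + d *: (1 : H)].
  elim: r => [|p r [Q [d [HQ [Od OdV] d0 E]]]].
    exists 0, 1; split; rewrite ?invr1 ?oner_neq0 // ?big_nil ?mulr0 ?add0r ?scale1r //.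
    by rewrite -(scale0r (1 : H)); apply: cst_sub.
  exists (T 0%N * Q + d *: (1 : H) - u p *: Q), (- u p * d); split.
  - apply: gen_sub_add; last by rewrite -scaleNr -mulN1r; apply: scale_sub => //;
    apply: OM.
    apply: gen_sub_add; last exact: cst_sub.
    by apply: gen_sub_mul => //; apply: gen_sub_T.
  - split; first by apply: OM => //; rewrite -mulN1r; apply: OM.
    by rewrite invfM invrN; apply: OM => //; rewrite -mulN1r; apply: OM.
  - by rewrite mulf_neq0 ?oppr_eq0.
  rewrite big_cons E mulrBl mulrBr -AK_scalerAl mul1r scalerDr -!AK_scalerAr.
  by rewrite scalerA opprD mulNr scaleNr addrA.
have [Q [d [HQ [Od OdV] d0 E]]] := P (index_enum 'I_e).
move: E; rewrite (@AK_cyclotomicE _ _ q u nat (@id nat)) //.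
move=> /(congr1 ( *%R y)); rewrite mulr0 mulrDr mulrA yT mul1r -AK_scalerAr mulr1.
move=> /esym/eqP; rewrite addr_eq0 => /eqP {}E.
rewrite -[y]scale1r -(mulVf d0) -scalerA; apply: scale_sub => //.
by rewrite -[_ *: y]opprK -E -scaleN1r; apply: scale_sub.
Qed.

Section Trace.
Variables (z : F) (y : nat -> F) (tau : {scalar H}).
Hypothesis tau_markov : is_markov_trace z y tau.

(** The convention [y_0 = 1], by which the rule for powers of [L n] includes the exponent 0. *)
Definition trace_L_value (j : nat) : F := if j is 0 then 1 else y j.

Lemma trace_T n a b : (0 < n)%N -> sub n a -> sub n b ->
  tau (a * T n * b) = z * tau (b * a).
Proof.
have [_ tauC tauT _] := tau_markov => n_gt0 Ha Hb.
have [h hE] : exists h : AKn q u n, AKn_incl h = b * a.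
  exact/gen_sub_AKn_incl/gen_sub_mul.
by rewrite -hE -tauT // hE [LHS]tauC mulrA.
Qed.

Lemma trace_L n j a b : (j < e)%N -> sub n a -> sub n b ->
  tau (a * AKL q u n ^+ j * b) = trace_L_value j * tau (b * a).
Proof.
have [_ tauC _ tauL] := tau_markov => j_e Ha Hb.
have [h hE] : exists h : AKn q u n, AKn_incl h = b * a.
  exact/gen_sub_AKn_incl/gen_sub_mul.
rewrite [LHS]tauC mulrA; case: j j_e => [|j] j_e; first by rewrite expr0 mulr1 mul1r.
by rewrite -hE tauL //= -ltnS prednK.
Qed.

Variable lam : F.
Hypotheses (Olam : O lam) (Olamz : O (lam * z)) (Oy : forall j, O (y j)).

Let O_L_value j : O (trace_L_value j). Proof. by case: j => /=. Qed.

(** Each passage to a smaller algebra releases one [lam] and at most one [z]; both [lam] and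
    [lam * z] lie in [O], even where [z] does not. *)
Lemma trace_integral n x : sub n.+1 x -> O (lam ^+ n * tau x).
Proof.
have [tau1 _ _ _] := tau_markov.
elim: n x => [|n IHn] x /AK_gen_sub_markov; elim=> {x} [|x|x x' _ Hx _ Hx'].
- by rewrite linear0 mulr0.
- case=> [j a b j_e Ha Hb|a b //].
  have [c Oc E] : AK_scalar (b * a) by apply/AK_scalar_gen_sub0/gen_sub_mul.
  by rewrite trace_L // E linearZ /= tau1 mul1r mulr1; apply: OM.
- by rewrite linearD mulrDr; apply: OD.
- by rewrite linear0 mulr0.
- case=> [j a b j_e Ha Hb|a b _ Ha Hb].
    rewrite trace_L // exprS mulrCA -mulrA; apply: OM => //; apply: OM => //.
    exact/IHn/gen_sub_mul.
  rewrite trace_T // exprSr mulrA -(mulrA _ lam) (mulrC _ (lam * z)) -mulrA.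
  by apply: OM => //; apply/IHn/gen_sub_mul.
- by rewrite linearD mulrDr; apply: OD.
Qed.

End Trace.
End OneAlgebra.

(** * Comparison of the trace with a combination of traces pulled back along the [f_p] *)

Section TraceComparison.
Variables (e e' : nat) (u : 'I_e -> F) (u' : 'I_e' -> F).
Hypotheses (e_gt0 : (0 < e)%N) (e'_gt0 : (0 < e')%N).
Hypotheses (u_neq0 : forall p, u p != 0) (u'_neq0 : forall p, u' p != 0).
Hypotheses (Ou : forall p, O (u p)) (Ou' : forall p, O (u' p)).
Local Notation f p := (@T0_scalar F e e' q u u' p).

Lemma T0_scalar_ring_inv p i : f p (ring_inv (AKT q u i)) = ring_inv (f p (AKT q u i)).
Proof.
apply: morph_ring_inv; [exact: T0_scalarM|exact: T0_scalar1|].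
by have [] := AKT_ring_inv u_neq0 i; exists (ring_inv (AKT q u i)).
Qed.

(** [L_n] is a conjugate of [T_0], whose image is a central scalar. *)
Lemma T0_scalar_L p n : f p (AKL q u n) = u p *: (1 : AK q u').
Proof.
elim: n => [|n IH]; first exact: T0_scalar_T0.
rewrite /= !T0_scalarM IH T0_scalar_ring_inv T0_scalar_T.
rewrite -AK_scalerAr mulr1 -AK_scalerAl; congr (_ *: _).
by case: (AKT_ring_inv u'_neq0 n.+1).
Qed.

Lemma T0_scalar_X p x j : f p (x ^+ j) = f p x ^+ j.
Proof.
elim: j => [|j IH]; first exact: T0_scalar1.
by rewrite !exprS T0_scalarM IH.
Qed.

Lemma T0_scalar_LX p n j a b :
  f p (a * AKL q u n ^+ j * b) = u p ^+ j *: f p (a * b).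
Proof.
rewrite !T0_scalarM T0_scalar_X T0_scalar_L.
have -> : (u p *: (1 : AK q u')) ^+ j = u p ^+ j *: (1 : AK q u').
  elim: j => [|j IH]; first by rewrite scale1r.
  by rewrite exprS IH -AK_scalerAl mul1r scalerA -exprS.
by rewrite -AK_scalerAr mulr1 -AK_scalerAl.
Qed.

Lemma T0_scalar_gen_sub p n x : gen_sub (@AK_scalar e u) (AKT q u) n x ->
  gen_sub (@AK_scalar e' u') (AKT q u') n (f p x).
Proof.
elim=> {x} [_ [c Oc ->]|[|i] i_n|x y _ Hx _ Hy|x y _ Hx _ Hy].
- by rewrite T0_scalarZ T0_scalar1; apply: gen_sub_cst; exists c.
- by rewrite T0_scalar_T0; apply: gen_sub_cst; exists (u p).
- by rewrite T0_scalar_T; apply: gen_sub_T.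
- by rewrite T0_scalarD; apply: gen_sub_add.
- by rewrite T0_scalarM; apply: gen_sub_mul.
Qed.

Variables (z : F) (y y' : nat -> F) (tau : {scalar AK q u}) (tau' : {scalar AK q u'}).
Hypotheses (tau_markov : is_markov_trace z y tau)
           (tau'_markov : is_markov_trace z y' tau').
(** [m] stands for the ideal of functions vanishing at the evaluation point, and [lam] for the
    normalising factor. *)
Variables (m : F -> Prop) (lam : F).
Hypothesis mD : forall a b, m a -> m b -> m (a + b).
Hypothesis mM : forall a b, O a -> m b -> m (a * b).
Hypotheses (mlam : m lam) (Olam : O lam) (Olamz : O (lam * z)).
Hypotheses (Oy : forall j, O (y j)) (Oy' : forall j, O (y' j)).
Variable c : 'I_e -> F.
Hypothesis Oc : forall p, O (c p).
Hypothesis c_interp : forall j, (j < e)%N ->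
  \sum_(p < e) c p * u p ^+ j = trace_L_value y j.

Lemma trace_comparison n x : gen_sub (@AK_scalar e u) (AKT q u) n.+1 x ->
  m (lam ^+ n * tau x - \sum_(p < e) c p * (lam ^+ n * tau' (f p x))).
Proof.
have m0 : m 0 by rewrite -(mul0r lam); apply: mM.
have OX a j : O a -> O (a ^+ j).
  by move=> Oa; elim: j => [|j IH]; rewrite ?expr0 // exprS; apply: OM.
have [tau1 tauC _ _] := tau_markov; have [tau'1 tau'C _ _] := tau'_markov.
have f0 p : f p 0 = 0 by apply: (addrI (f p 0)); rewrite -T0_scalarD !addr0.
have S0 k : m (lam ^+ k * tau 0 - \sum_(p < e) c p * (lam ^+ k * tau' (f p 0))).
  rewrite linear0 mulr0 big1 ?subr0 // => p _.
  by rewrite f0 linear0 !mulr0.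
have SD k x1 x2 :
    m (lam ^+ k * tau x1 - \sum_(p < e) c p * (lam ^+ k * tau' (f p x1))) ->
    m (lam ^+ k * tau x2 - \sum_(p < e) c p * (lam ^+ k * tau' (f p x2))) ->
    m (lam ^+ k * tau (x1 + x2) - \sum_(p < e) c p * (lam ^+ k * tau' (f p (x1 + x2)))).
  move=> H1 H2; have := mD H1 H2; congr m; rewrite linearD mulrDr addrACA -opprD.
  congr (_ - _); rewrite -big_split /=; apply: eq_bigr => p _.
  by rewrite T0_scalarD linearD !mulrDr.
have tau'L k j p a b :
    tau' (f p (a * AKL q u k ^+ j * b)) = u p ^+ j * tau' (f p (b * a)).
  by rewrite T0_scalar_LX linearZ /= T0_scalarM tau'C -T0_scalarM.
elim: n x => [|n IHn] x /(AK_gen_sub_markov e_gt0 u_neq0 Ou); elim=> {x} //.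
- move=> _ [j a b j_e Ha Hb|a b //].
  (* For [n = 0] the coefficients are scalars, and the difference is exactly 0 by [c_interp]. *)
  have [d Od E] : AK_scalar (b * a) by apply/AK_scalar_gen_sub0/gen_sub_mul.
  rewrite (trace_L e_gt0 tau_markov) // E linearZ /= tau1 mul1r mulr1 -c_interp //
    mulr_suml.
  rewrite -sumrB big1 // => p _.
  by rewrite (tau'L 0%N) E T0_scalarZ T0_scalar1 linearZ /= tau'1 mul1r mulr1 mulrA
    subrr.
- move=> x x' _ + _; exact: SD.
- move=> _ [j a b j_e Ha Hb|a b _ Ha Hb].
    (* The rule for powers of [L n.+1] produces no [z], so one [lam] is left over and puts each of
       the two traces separately into [m]. *)
    have mlamS v w : O w -> O (lam ^+ n * v) -> m (w * (lam ^+ n.+1 * v)).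
      move=> Ow Ov; have -> : w * (lam ^+ n.+1 * v) = w * (lam ^+ n * v) * lam.
        by rewrite exprS; ring.
      by apply: mM => //; apply: OM.
    have Hba := gen_sub_mul Hb Ha.
    rewrite (trace_L e_gt0 tau_markov) //; apply: mD.
      rewrite mulrCA; apply: mlamS; first by case: (j) => /=.
      exact: (trace_integral e_gt0 u_neq0 Ou tau_markov).
    rewrite -mulN1r; apply: mM => //; apply: big_ind => // p _.
    rewrite tau'L (mulrCA (lam ^+ n.+1)) (mulrA (c p)); apply: mlamS;
      first by apply: OM => //; apply: OX.
    apply: (trace_integral e'_gt0 u'_neq0 Ou' tau'_markov) => //.
    exact: T0_scalar_gen_sub.
  (* Both traces release the same [z], so the difference is [lam * z] times that of the induction
     hypothesis at [b * a]. *)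
  rewrite (trace_T tau_markov) //.
  have := mM Olamz (IHn _ (gen_sub_mul Hb Ha)); congr m; rewrite mulrBr mulr_sumr.
  congr (_ - _); first by rewrite exprS; ring.
  apply: eq_bigr => p _; rewrite !T0_scalarM T0_scalar_T.
  rewrite (trace_T tau'_markov) //; try exact: T0_scalar_gen_sub.
  by rewrite exprS; ring.
- move=> x x' _ + _; exact: SD.
Qed.

End TraceComparison.
End ArikiKoikeLattice.

(** * Rational functions regular at a point, and their values *)

Section RationalFunctionValue.
Variables (K E : fieldType) (iota : {rmorphism K -> E}) (a : E).
Local Notation Kt := {fraction {poly K}}.

(* Unlike ratfun_eval, which is 0 at a pole, this also asserts regularity at a. *)
Definition has_value (f : Kt) (v : E) : Prop := exists P D : {poly K},
  [/\ (map_poly iota D).[a] != 0, f = tofrac P / tofrac D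
    & v = (map_poly iota P).[a] / (map_poly iota D).[a]].

Lemma has_value_eval f v : has_value f v -> ratfun_eval iota a f = v.
Proof. by case=> P [D [Da -> ->]]; rewrite ratfun_evalE. Qed.

Let tofrac_neq0 (D : {poly K}) : (map_poly iota D).[a] != 0 -> tofrac D != 0 :> Kt.
Proof.
by apply: contraNneq => /eqP; rewrite tofrac_eq0 => /eqP ->;
  rewrite rmorph0 horner0. Qed.

Lemma has_value_poly P : has_value (tofrac P) (map_poly iota P).[a].
Proof.
have D1 : (map_poly iota 1).[a] = 1 by rewrite rmorph1 hornerC.
by exists P, 1; rewrite D1 rmorph1 !divr1 oner_neq0.
Qed.

Lemma has_value_cst c : has_value (ratfun_cst c) (iota c).
Proof. by have := has_value_poly c%:P; rewrite map_polyC hornerC. Qed.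

Lemma has_valueD f g v w : has_value f v -> has_value g w -> has_value (f + g) (v + w).
Proof.
move=> [P [D [Da -> ->]]] [P' [D' [D'a -> ->]]].
exists (P * D' + P' * D), (D * D'); split; first by rewrite rmorphM hornerM mulf_neq0.
  by rewrite tofracD !tofracM addf_div ?tofrac_neq0.
by rewrite rmorphD !rmorphM hornerD !hornerM addf_div.
Qed.

Lemma has_valueM f g v w : has_value f v -> has_value g w -> has_value (f * g) (v * w).
Proof.
move=> [P [D [Da -> ->]]] [P' [D' [D'a -> ->]]].
exists (P * P'), (D * D'); split; first by rewrite rmorphM hornerM mulf_neq0.
  by rewrite !tofracM mulf_div.
by rewrite !rmorphM !hornerM mulf_div.
Qed.

Lemma has_valueV f v : v != 0 -> has_value f v -> has_value f^-1 v^-1.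
Proof.
move=> v0 [P [D [Da -> vE]]]; exists D, P; split; last by rewrite vE invf_div.
  by apply: contraNneq v0 => P0; rewrite vE P0 mul0r.
by rewrite invf_div.
Qed.

End RationalFunctionValue.

(** * Lagrange interpolation at [u_1, ..., u_e] and the weights [C(e,p)] *)

Section LagrangeInterpolation.
Variables (K : fieldType) (e : nat) (u : 'I_e -> K).
Hypothesis u_inj : injective u.

Definition cofactor_poly (p : 'I_e) : {poly K} :=
  \prod_(l < e | l != p) ('X - (u l)%:P).

Lemma cofactor_poly_mul p :
  \prod_(l < e) ('X - (u l)%:P) = ('X - (u p)%:P) * cofactor_poly p.
Proof. by rewrite (bigD1 p). Qed.

Lemma size_cofactor_poly p : size (cofactor_poly p) = e.
Proof.
have := congr1 (fun P : {poly K} => size P) (cofactor_poly_mul p).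
rewrite size_prod_XsubC size_index_enum_ord size_mul ?polyXsubC_eq0 //; last first.
  by rewrite monic_neq0 // monic_prod_XsubC.
by rewrite size_XsubC; case.
Qed.

Lemma horner_cofactor_poly p l : (cofactor_poly p).[u l] =
  if l == p then \prod_(k < e | k != p) (u p - u k) else 0.
Proof.
rewrite horner_prod (eq_bigr (fun k => u l - u k)); last by move=> k _;
  rewrite !hornerE.
case: eqP => [->//|/eqP lp].
by apply/eqP/prodf_eq0; exists l => //; rewrite subrr.
Qed.

(** The difference of the two sides has degree below [e] and vanishes at the [e] distinct points
    [u_p]. *)
Lemma lagrange_interpolation (P : {poly K}) : (size P <= e)%N ->
  P = \sum_(p < e) (P.[u p] * \prod_(l < e | l != p) (1 / (u p - u l))) *:
    cofactor_poly p.
Proof.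
move=> Pe; apply/eqP; rewrite -subr_eq0; apply/eqP.
apply: (@roots_geq_poly_eq0 _ _ (map u (enum 'I_e))).
- apply/allP => _ /mapP[l _ ->]; rewrite /root hornerD hornerN horner_sum.
  rewrite [X in _ - X](bigD1 l) //= [X in _ - (_ + X)]big1 ?addr0 => [|p pl];
    last first.
    by rewrite hornerZ horner_cofactor_poly eq_sym (negbTE pl) mulr0.
  rewrite hornerZ horner_cofactor_poly eqxx -mulrA -big_split /= big1 ?mulr1 ?subrr // =>
    p pl.
  by rewrite div1r mulVf // subr_eq0; apply: contraNneq pl => /u_inj ->.
- by rewrite map_inj_uniq ?enum_uniq.
rewrite size_map size_enum_ord; apply: leq_trans (size_polyD _ _) _.
rewrite geq_max Pe size_polyN; apply: leq_trans (size_sum _ _ _) _.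
apply/bigmax_leqP => p _; apply: leq_trans (size_scale_leq _ _) _.
by rewrite size_cofactor_poly.
Qed.

(** The linear functional [X^i |-> s i] is applied to the interpolation formula of [X^j]. *)
Lemma sum_lagrange_functional (s : nat -> K) j : (j < e)%N ->
  \sum_(p < e) (\sum_(i < e) s i * (cofactor_poly p)`_i) *
     (\prod_(l < e | l != p) (1 / (u p - u l))) * u p ^+ j = s j.
Proof.
move=> j_e; have := @lagrange_interpolation 'X^j; rewrite size_polyXn => /(_ j_e) E.
transitivity (\sum_(i < e) s i * ('X^j : {poly K})`_i).
  rewrite [in RHS]E; under [RHS]eq_bigr do rewrite coef_sum mulr_sumr.
  rewrite exchange_big /=; apply: eq_bigr => p _.
  rewrite -mulrA mulr_suml; apply: eq_bigr => i _.
  by rewrite coefZ hornerXn; ring.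
rewrite (bigD1 (Ordinal j_e)) //= coefXn eqxx mulr1 big1 ?addr0 // => i ij.
by rewrite coefXn -val_eqE /= in ij *; rewrite (negbTE ij) mulr0.
Qed.

Local Notation sigma d := ((mesym e K d).@[u]).

(** Synthetic division by [X - u_p] of the product of all [X - u_l], whose coefficients are signed
    elementary symmetric polynomials; [rec] is one step of it, starting above the degree of the
    quotient. *)
Lemma coef_cofactor_poly p k : (k < e)%N ->
  (cofactor_poly p)`_(e - k.+1) = \sum_(d < k.+1) (-1) ^+ d * sigma d * u p ^+ (k - d).
Proof.
have coefP d : (d <= e)%N ->
    (\prod_(l < e) ('X - (u l)%:P))`_(e - d) = (-1) ^+ d * sigma d.
  rewrite -ltnS => d_e; have := mroots_coeff (mktuple u) (Ordinal d_e).
  rewrite big_tuple /= (eq_bigr (fun l => 'X - (u l)%:P)) => [->|l _];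
    last by rewrite tnth_mktuple.
  by congr (_ * _); apply: meval_eq => l; rewrite tnth_mktuple.
have rec d : (d < e)%N -> (cofactor_poly p)`_(e - d.+1) =
    (-1) ^+ d * sigma d + u p * (cofactor_poly p)`_(e - d).
  move=> d_e;
    rewrite -(coefP d (ltnW d_e)) (cofactor_poly_mul p) mulrBl coefB coefXM coefCM.
  by rewrite subn_eq0 leqNgt d_e /= subrK subnS.
elim: k => [|k IH] k_e.
  rewrite rec // subn0 [_`_e]nth_default ?size_cofactor_poly // mulr0 addr0.
  by rewrite big_ord1 mulr1.
rewrite rec // IH ?(ltnW k_e) // [RHS]big_ord_recr /= subnn mulr1 addrC; congr (_ + _).
rewrite mulr_sumr; apply: eq_bigr => d _.
by rewrite subSn ?exprS; [ring|rewrite -ltnS].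
Qed.

Lemma coef0_cofactor_poly p :
  (cofactor_poly p)`_0 = (-1) ^+ (e - 1) * \prod_(l < e | l != p) u l.
Proof.
rewrite -horner_coef0 horner_prod (eq_bigr (fun l => - u l)); last first.
  by move=> l _; rewrite !hornerE.
rewrite prodrN; congr (_ ^+ _ * _).
by rewrite (eq_card (B := predC1 p)) // cardC1 card_ord subn1.
Qed.

(** [C(e,p)] is the value of the functional [X^i |-> y_i] at the cofactor polynomial: the double sum
    is regrouped by [y_j], whose factor is the coefficient of [X^j], and the final product is the
    constant coefficient, paired with [y_0 = 1]. *)
Lemma weight_functional (y : nat -> K) p :
  \sum_(1 <= i < e) (u p ^+ (e - i - 1) *
    \sum_(1 <= j < i.+1) (-1) ^+ (i - j) * y j * sigma (i - j))
  + (-1) ^+ (e - 1) * \prod_(l < e | l != p) u l =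
  \sum_(i < e) trace_L_value y i * (cofactor_poly p)`_i.
Proof.
have e_gt0 : (0 < e)%N by apply: leq_trans (ltn_ord p).
rewrite -coef0_cofactor_poly -(big_mkord xpredT (fun i =>
  trace_L_value y i * (cofactor_poly p)`_i)).
rewrite [RHS]big_ltn //= mul1r addrC; congr (_ + _).
transitivity (\sum_(1 <= i < e) \sum_(1 <= j < e | (j < i.+1)%N)
    u p ^+ (e - i - 1) * ((-1) ^+ (i - j) * y j * sigma (i - j))).
  rewrite !big_nat; apply: eq_bigr => i /andP[_ i_e].
  by rewrite mulr_sumr (big_nat_widen _ _ e).
rewrite (exchange_big_dep_nat xpredT) //= !big_nat;
  apply: eq_bigr => j /andP[j_gt0 j_e].
under eq_bigl do rewrite ltnS.
(* The inner sum is reindexed by [d = i - j], to match [coef_cofactor_poly] with [k = e - j - 1]. *)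
rewrite -(big_nat_widenl _ _ _ xpredT) // -{1}[j]add0n big_addn.
have -> : trace_L_value y j = y j by case: (j) j_gt0.
have kE : (e - j = (e - j.+1).+1)%N by rewrite -subSn.
have -> : (cofactor_poly p)`_j = \sum_(0 <= d < e - j)
    (-1) ^+ d * sigma d * u p ^+ (e - j.+1 - d).
  rewrite kE big_mkord -coef_cofactor_poly; last by rewrite -kE leq_subr.
  by rewrite -kE subKn // ltnW.
rewrite mulr_sumr; apply: eq_bigr => d _.
by rewrite addnK addnC -subnDA addn1 -addSn subnDA; ring.
Qed.

End LagrangeInterpolation.

(** * Images of mixed braids in the algebras *)

Section BraidImage.
Variables (F : fieldType) (e e' : nat) (q : F) (u : 'I_e -> F) (u' : 'I_e' -> F).
Hypotheses (q_neq0 : q != 0).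
Hypotheses (u_neq0 : forall p, u p != 0) (u'_neq0 : forall p, u' p != 0).

Lemma AKn_incl_ring_inv e1 (v : 'I_e1 -> F) n (i : 'I_n) : (forall p, v p != 0) ->
  AKn_incl (ring_inv (AKnT q v i)) = ring_inv (AKT q v i).
Proof.
move=> v_neq0; rewrite -AKn_incl_gen.
apply: morph_ring_inv; [exact: AKn_inclM|exact: AKn_incl1|exact: AK_gen_inv].
Qed.

(** Letter by letter on a representing word: a letter [t_0] or its inverse contributes the central
    scalar [u_p] or its inverse, which can be collected in front, and every other letter is kept. *)
Lemma T0_scalar_braid p n (alpha : aff_braid n) :
  T0_scalar u' p (AKn_incl (braid_AK q u alpha)) =
    u p ^ writhe0 alpha *: AKn_incl (braid_AK q u' (delete_t0 alpha)).
Proof.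
elim/quotW: alpha => w; rewrite writhe0_pi delete_t0_pi !braid_AK_pi //.
elim: w => [|[i b] w IH].
  rewrite /word_val /exponent_sum !big_nil !AKn_incl1 T0_scalar1.
  by rewrite expr0z scale1r.
rewrite -cat1s filter_cat exponent_sum_cat expfzDr // !word_val_cat !AKn_inclM
  T0_scalarM IH.
rewrite -AK_scalerAr mulrC -scalerA; congr (_ *: _).
rewrite AK_scalerAl; congr (_ * _).
rewrite /word_val /exponent_sum /= !big_cons !big_nil /= mulr1.
have -> : T0_scalar u' p (AKn_incl (if b then ring_inv (AKnT q u i) else AKnT q u i)) =
    if b then ring_inv (T0_scalar u' p (AKT q u i)) else T0_scalar u' p (AKT q u i).
  by case: b; rewrite ?AKn_incl_ring_inv ?T0_scalar_ring_inv ?AKn_incl_gen.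
case: i => -[|i] i_n /=.
  rewrite big_nil AKn_incl1 T0_scalar_T0 addr0.
  case: b => //; apply: ring_invE; rewrite -AK_scalerAl mul1r scalerA.
    by rewrite exprN1 mulfV // scale1r.
  by rewrite exprN1 mulVf // scale1r.
rewrite expr0z big_cons big_nil mulr1 scale1r T0_scalar_T /=.
by case: b; rewrite ?AKn_incl_ring_inv ?AKn_incl_gen.
Qed.

Lemma writhe_delete_t0 n (alpha : aff_braid n) :
  writhe (delete_t0 alpha) = writhe alpha.
Proof.
elim/quotW: alpha => w; rewrite delete_t0_pi !writhe_pi /exponent_sum big_filter_cond.
by apply: eq_bigl => x; rewrite andbb.
Qed.

Lemma braid_gen_sub (O : F -> Prop) n (alpha : aff_braid n) :
  O 1 -> O (-1) -> O q -> O q^-1 -> (forall a b, O a -> O b -> O (a + b)) ->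
  (forall a b, O a -> O b -> O (a * b)) ->
  (forall p, O (u p)) -> (forall p, O (u p)^-1) ->
  gen_sub (@AK_scalar F O q e u) (AKT q u) n (AKn_incl (braid_AK q u alpha)).
Proof.
move=> O1 ON1 Oq OqV OD OM Ou OuV.
elim/quotW: alpha => w; rewrite braid_AK_pi //.
elim: w => [|[i b] w IH].
  by rewrite /word_val big_nil AKn_incl1; apply: gen_sub_cst; exists 1;
    rewrite ?scale1r.
rewrite -cat1s word_val_cat AKn_inclM; apply: gen_sub_mul => //.
rewrite /word_val big_cons big_nil mulr1; case: b => /=; last by rewrite AKn_incl_gen;
  apply: gen_sub_T.
by rewrite AKn_incl_ring_inv //; apply: gen_sub_ring_inv.
Qed.

End BraidImage.

(** * Evaluation at [t^(1/2) = q^(-1/2)] *)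

Section AlexanderComparison.
Variables (K : fieldType) (e : nat) (q : K) (u : 'I_e -> K).
Hypotheses (e_gt0 : (0 < e)%N) (q_neq0 : q != 0) (q_neq1 : 1 - q != 0).
Hypothesis u_neq0 : forall p, u p != 0.
Variables (y : nat -> K) (c : 'I_e -> K).
Hypothesis c_interp : forall j, (j < e)%N ->
  \sum_(p < e) c p * u p ^+ j = trace_L_value y j.
Variables (E : fieldType) (iota : {rmorphism K -> E}) (r : E).
Hypothesis r_sqr : r ^+ 2 = iota q.
Variables (tau : {scalar (AKt q u)}) (tauA : {scalar (AKt q (@u_typeA K))}).
Hypotheses (tau_trace : is_AKt_trace y tau) (tauA_trace : is_AKt_trace (fun=> 0) tauA).

Local Notation Kt := {fraction {poly K}}.
Local Notation hv := (has_value iota r^-1).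

(** [ratfun_cst] with its structure of ring morphism, to which it is convertible. *)
Let cst : {rmorphism K -> Kt} :=
  GRing.RMorphism.clone _ _ (@tofrac {poly K} \o polyC) _.

Let cst_neq0 (x : K) : x != 0 -> ratfun_cst x != 0.
Proof. by move=> x0; rewrite -[ratfun_cst x]/(cst x) fmorph_eq0. Qed.

Definition link_factor : Kt :=
  - ((1 - var_t K * ratfun_cst q) / (sqrt_t K * (1 - ratfun_cst q))).

Let r_neq0 : r != 0.
Proof.
by apply: contraNneq q_neq0 => r0; rewrite -(fmorph_eq0 iota) -r_sqr r0 expr0n.
Qed.

Let hv_sqrt : hv (sqrt_t K) r^-1.
Proof. by have := has_value_poly iota r^-1 'X; rewrite map_polyX hornerX. Qed.

Let hv_subcst f v : hv f v -> hv (1 - f) (1 - v).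
Proof.
move=> Hf; rewrite -(mulN1r f) -(mulN1r v).
have hv1 : hv 1 1 by have := has_value_cst iota r^-1 1; rewrite rmorph1.
have hvN1 : hv (-1) (-1).
  by have := has_value_cst iota r^-1 (-1); rewrite -[ratfun_cst _]/(cst _) !rmorphN1.
by apply: has_valueD => //; apply: has_valueM.
Qed.

(** The numerator [1 - t q] vanishes at [t = 1 / q], while the denominator takes the nonzero value
    [r^-1 (1 - q)]. *)
Let hv_factor : hv link_factor 0.
Proof.
have q'_neq0 : 1 - iota q != 0 by rewrite -(rmorph1 iota) -rmorphB fmorph_eq0.
have hvq := has_value_cst iota r^-1 q.
rewrite /link_factor -mulN1r.
have -> : (0 : E) = -1 * ((1 - (r^-1) ^+ 2 * iota q) / (r^-1 * (1 - iota q))).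
  by rewrite -r_sqr -exprMn mulVf // expr1n subrr mul0r mulr0.
apply: has_valueM.
  by have := has_value_cst iota r^-1 (-1); rewrite -[ratfun_cst _]/(cst _) !rmorphN1.
apply: has_valueM.
  by apply/hv_subcst/has_valueM => //; rewrite /var_t !expr2; apply: has_valueM.
apply: has_valueV; first by rewrite mulf_neq0 ?invr_eq0.
by apply: has_valueM => //; apply: hv_subcst.
Qed.

Let sqrt_neq0 : sqrt_t K != 0. Proof. by rewrite tofrac_eq0 polyX_eq0. Qed.

Let factor_z : link_factor * trace_z q = (sqrt_t K)^-1.
Proof.
have Q1 : 1 - ratfun_cst q != 0 by rewrite -[ratfun_cst q]/(cst q) -(rmorph1 cst)
  -rmorphB fmorph_eq0.
have TQ : 1 - var_t K * ratfun_cst q != 0.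
  (* The constant coefficients of [1] and of [q X^2] differ. *)
  rewrite subr_eq0; apply: contraNneq (oner_neq0 K) => /eqP.
  rewrite /var_t /sqrt_t -rmorphXn -tofracM -tofrac1 tofrac_eq =>
    /eqP /(congr1 (fun P : {poly K} => P`_0)).
  by rewrite coef1 coefMC coefXn mul0r => /eqP.
have cancel (F : fieldType) (a b s : F) : a != 0 -> b != 0 -> s != 0 ->
    a / (s * b) * (b / a) = s^-1.
  by move=> a0 b0 s0; field; rewrite a0 b0 s0.
rewrite /link_factor /trace_z mulrNN.
exact: cancel TQ Q1 sqrt_neq0.
Qed.

Lemma alexander_comparison n (alpha : aff_braid n) : (0 < n)%N ->
  alexander_G iota r tau alpha =
    alexander_G iota r tauA (delete_t0 alpha) *
    iota (\sum_(p < e) c p * u p ^ writhe0 alpha).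
Proof.
(* With [n.+1] strands the normalising factor has exponent [n], the one attached to the algebra of
   [T_0, ..., T_n]. *)
case: n alpha => // n alpha _.
(* [O] is the ring of functions regular at [r^-1], and [m] its ideal of functions vanishing
   there. *)
pose O f := exists v, hv f v; pose m f := hv f 0.
have Ocst x : O (ratfun_cst x) by exists (iota x); apply: has_value_cst.
have O1 : O 1 by apply: (Ocst 1).
have ON1 : O (-1) by have := Ocst (-1); rewrite -[ratfun_cst _]/(cst _) rmorphN1.
have OcstV x : O (ratfun_cst x)^-1 by have := Ocst x^-1;
  rewrite -[ratfun_cst _]/(cst _) fmorphV.
have OD a b : O a -> O b -> O (a + b).
  by move=> [v Ha] [w Hb]; exists (v + w); apply: has_valueD.
have OM a b : O a -> O b -> O (a * b).
  by move=> [v Ha] [w Hb]; exists (v * w); apply: has_valueM.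
have mD a b : m a -> m b -> m (a + b).
  by move=> Ha Hb; rewrite /m -(addr0 0); apply: has_valueD.
have mM a b : O a -> m b -> m (a * b).
  by move=> [v Ha] Hb; rewrite /m -(mulr0 v); apply: has_valueM.
have Osqrt : O (sqrt_t K) by exists r^-1.
have OsqrtV : O (sqrt_t K)^-1.
  by exists (r^-1)^-1; apply: has_valueV => //; rewrite invr_eq0.
have OsqrtX (k : int) : O (sqrt_t K ^ k).
  have OX a i : O a -> O (a ^+ i).
    by move=> Oa; elim: i => [|i IH]; rewrite ?expr0 // exprS; apply: OM.
  by case: k => k; [apply: OX|rewrite NegzE -exprz_inv; apply: OX].
have Olam : O link_factor by exists 0.
have Olamz : O (link_factor * trace_z q) by rewrite factor_z.
set U := fun p => ratfun_cst (u p); set UA := fun p => ratfun_cst (u_typeA K p).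
have U0 p : U p != 0 by apply: cst_neq0.
have UA0 p : UA p != 0 by apply/cst_neq0/oner_neq0.
have Q0 := cst_neq0 q_neq0; have OQ := Ocst q; have OQV := OcstV q.
have OU p : O (U p) by apply: Ocst.
have OUV p : O (U p)^-1 by apply: OcstV.
have OUA p : O (UA p) by apply: Ocst.
have OUAV p : O (UA p)^-1 by apply: OcstV.
pose x := AKn_incl (braid_AK (ratfun_cst q) U alpha).
have xS : gen_sub (@AK_scalar Kt O (ratfun_cst q) e U) (AKT (ratfun_cst q) U) n.+1 x.
  exact: braid_gen_sub.
pose xA := AKn_incl (braid_AK (ratfun_cst q) UA (delete_t0 alpha)).
have xAS :
    gen_sub (@AK_scalar Kt O (ratfun_cst q) 1 UA) (AKT (ratfun_cst q) UA) n.+1 xA.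
  exact: braid_gen_sub.
have OA : O (link_factor ^+ n * tauA xA).
  apply: (@trace_integral Kt O (ratfun_cst q) O1 ON1 _ _ OD OM Q0 1 UA isT UA0 _ _ _
    tauA tauA_trace) => //.
have C : m (link_factor ^+ n * tau x - \sum_(p < e) ratfun_cst (c p) *
    (link_factor ^+ n * tauA (T0_scalar UA p x))).
  apply: (@trace_comparison Kt O (ratfun_cst q) O1 ON1 _ _ OD OM Q0 e 1 U UA e_gt0 isT
    U0 UA0 _ _
    (trace_z q) _ _ tau tauA tau_trace tauA_trace m link_factor mD mM) => //.
  move=> j /c_interp cj; rewrite -[RHS]/(trace_L_value (fun j => cst (y j)) j).
  transitivity (cst (trace_L_value y j)); last by case: (j) => /=; rewrite ?rmorph1.
  by rewrite -cj rmorph_sum; apply: eq_bigr => p _; rewrite rmorphM rmorphXn.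
(* All the [f_p] send the braid to the same type A element up to a power of [u_p], so the sum over
   [p] separates from the trace. *)
have E1 : \sum_(p < e) ratfun_cst (c p) * (link_factor ^+ n * tauA (T0_scalar UA p x)) =
    link_factor ^+ n * tauA xA * cst (\sum_(p < e) c p * u p ^ writhe0 alpha).
  rewrite rmorph_sum mulr_sumr; apply: eq_bigr => p _.
  rewrite T0_scalar_braid // linearZ /= rmorphM /= -/xA.
  have -> : U p ^ writhe0 alpha = cst (u p ^ writhe0 alpha) by rewrite fmorphXz.
  by rewrite -[ratfun_cst (c p)]/(cst (c p)) mulrCA !mulrA; ring.
pose W := \sum_(p < e) c p * u p ^ writhe0 alpha.
(* Regularity has to be shown: at a pole [ratfun_eval] would return the default 0. *)
have [v vA] : O (link_invariant tauA (delete_t0 alpha)).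
  have := OM _ _ (OsqrtX (writhe (delete_t0 alpha))) OA; congr O.
  by rewrite /link_invariant -/link_factor /= -/xA; ring.
rewrite /alexander_G (has_value_eval vA).
apply: has_value_eval.
(* The invariant of [alpha] is the type A invariant times the constant [W], plus a power of
   [t^(1/2)] times an element of [m]; the writhes agree since [t_0] does not count. *)
have := has_valueD (mM _ _ (OsqrtX (writhe alpha)) C)
  (has_valueM vA (has_value_cst iota r^-1 W)).
rewrite add0r; congr hv; rewrite E1 /link_invariant writhe_delete_t0.
rewrite -/link_factor -/xA -/x /= -[ratfun_cst W]/(cst W); ring.
Qed.

End AlexanderComparison.

(** * The indeterminates of the base field, and the final formula *)

Lemma mpolyX_neq0 n (i : 'I_n) : 'X_i != 0 :> {mpoly rat[n]}.
Proof.
apply/eqP => /(congr1 (mcoeff U_(i)%MM)) /eqP.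
by rewrite mcoeffXU eqxx mcoeff0 oner_eq0.
Qed.

Lemma base_q_neq0 e : base_q e != 0.
Proof. by rewrite tofrac_eq0 mpolyX_neq0. Qed.

Lemma base_u_neq0 e (p : 'I_e) : base_u p != 0.
Proof. by rewrite tofrac_eq0 mpolyX_neq0. Qed.

Lemma base_q_neq1 e : 1 - base_q e != 0.
Proof.
rewrite subr_eq0 /base_q -tofrac1 tofrac_eq.
apply/eqP => /(congr1 (mcoeff 0%MM)) /eqP.
by rewrite mcoeff1 mcoeffX eqxx mnm1_eq0 oner_eq0.
Qed.

Lemma base_u_inj e : injective (@base_u e).
Proof.
move=> p l /eqP; rewrite tofrac_eq => /eqP /(congr1 (mcoeff U_(lift ord0 p)%MM)) /eqP.
rewrite !mcoeffXU eqxx (inj_eq lift_inj).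
by case: (l =P p) => [->//|_]; rewrite oner_eq0.
Qed.

Theorem theorem6p10 (e n : nat) (he : (1 <= e)%N) (hn : (1 <= n)%N)
    (y : nat -> base_field e)
    (E : fieldType) (iota : {rmorphism base_field e -> E})
    (r : E) (hr : r ^+ 2 = iota (base_q e))
    (tau : {scalar (AKt (base_q e) (@base_u e))})
    (htau : is_AKt_trace y tau)
    (tauA : {scalar (AKt (base_q e) (@u_typeA (base_field e)))})
    (htauA : is_AKt_trace (fun=> 0) tauA)
    (alpha : aff_braid n) :
  alexander_G iota r tau alpha =
    alexander_G iota r tauA (delete_t0 alpha) *
    iota (\sum_(p < e) weight_C y p * base_u p ^ writhe0 alpha *
            (\prod_(l < e | l != p) (1 / (base_u p - base_u l)))).
Proof.
rewrite (alexander_comparison he (base_q_neq0 e) (base_q_neq1 e) (@base_u_neq0 e) (y := y)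
  (c := fun p => weight_C y p * \prod_(l < e | l != p) (1 / (base_u p - base_u l)))
  _ hr htau htauA) //.
  by congr (_ * iota _); apply: eq_bigr => p _; rewrite mulrAC.
(* The chosen weights solve the interpolation system, once [weight_C] is read as a functional on the
   cofactor polynomials. *)
move=> j j_e; rewrite -(sum_lagrange_functional (@base_u_inj e) _ j_e).
by apply: eq_bigr => p _; rewrite -weight_functional.
Qed.
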